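(* Let $G$ be a countable discrete amenable group, $X=\mathbb{N}^G$, and let $\phi\colon X\to\mathbb{R}$ be an exp-summable potential with summable variation according to an exhausting sequence $\{E_m\}_m$ of $G$. If $\mu$ is a DLR measure for $\phi$, then for every $\epsilon>0$ there exist $K\in\mathcal{F}(G)$ and $\delta>0$ such that for every $(K,\delta)$-invariant set $F\in\mathcal{F}(G)$, every $w\in\mathbb{N}^F$ and every $y\in X$ with $y_F=w$, it holds for $\mu$-almost every $x$ that $$\exp(-\epsilon|F|)\leq\frac{\mu([w]\,|\,\mathcal{B}_{F^c})(x)}{\exp(\phi_F(y)-p(\phi)|F|)}\leq\exp(\epsilon|F|).$$ In particular, $\mu$ is a Bowen-Gibbs measure for $\phi$.
   Context: $\mathbb{N}$ is the set of non-negative integers; $\mathcal{F}(G)$ is the set of nonempty finite subsets of $G$. $X=\mathbb{N}^G$ has the product topology and Borel $\sigma$-algebra $\mathcal{B}$; for $D\subseteq G$, $\mathcal{B}_D$ is the $\sigma$-algebra generated by the coordinates in $D$. $x_D$ is the restriction of $x$ to $D$; for $w\in\mathbb{N}^F$, $[w]=\{x:x_F=w\}$ and $wx_{F^c}$ is the configuration equal to $w$ on $F$ and to $x$ on $F^c=G\setminus F$. $G$ acts by $(g\cdot x)(h)=x(hg)$; $\phi_F(x)=\sum_{g\in F}\phi(g\cdot x)$. $F\in\mathcal F(G)$ is $(K,\delta)$-invariant if $|KF\,\triangle\,F|<\delta|F|$; $G$ is amenable if such $F$ exist for all $K\in\mathcal{F}(G),\delta>0$. $\lim_{F\to G}\varphi(F)=L$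 means: for every $\epsilon>0$ there are $K\in\mathcal F(G),\delta>0$ with $|\varphi(F)-L|<\epsilon$ for every $(K,\delta)$-invariant $F$. An exhausting sequence is a sequence $\{E_m\}_{m\ge0}$ of finite subsets of $G$ with $E_0=\emptyset$, $E_1=\{1_G\}$, strictly increasing, with union $G$. With $\delta_E(\phi)=\sup\{|\phi(x)-\phi(y)|:x_E=y_E\}$, $\phi$ has summable variation according to $\{E_m\}_m$ if $\sum_{m\ge1}|E_{m+1}^{-1}\setminus E_m^{-1}|\,\delta_{E_m}(\phi)<\infty$. $\phi$ is exp-summable if $\sum_{a\in\mathbb{N}}\exp(\sup\{\phi(x):x(1_G)=a\})<\infty$. The pressure is $p(\phi)=\lim_{F\to G}\frac1{|F|}\log Z_F(\phi)$, $Z_F(\phi)=\sum_{w\in\mathbb{N}^F}\exp(\sup\phi_F([w]))$; it exists under the present hypotheses. DLR measure: for $K\in\mathcal{F}(G)$, $B\in\mathcal{B}$, $x\in X$ let $$\gamma_K(B,x)=\lim_{m\to\infty}\frac{\sum_{w\in\mathbb{N}^K}\exp(\phi_{E_m}(wx_{K^c}))\mathbf{1}_{\{wx_{K^c}\in B\}}}{\sum_{v\in\mathbb{N}^K}\exp(\phi_{E_m}(vx_{K^c}))}$$ (the limit exists under the present hypotheses). A Borel probability measure $\mu$ on $X$ is a DLR measure for $\phi$ if $\mu(B\,|\,\mathcal{B}_{K^c})(x)=\gamma_K(B,x)$ for $\mu$-a.e. $x$, for every $K\in\mathcal{F}(G)$, $B\in\mathcal{B}$. Bowen-Gibbs measure: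 a Borel probability measure $\mu$ on $X$ is a Bowen-Gibbs measure for $\phi$ if there is $p\in\mathbb{R}$ such that for every $\epsilon>0$ there are $K\in\mathcal{F}(G)$ and $\delta>0$ with $\exp(-\epsilon|F|)\le\frac{\mu([x_F])}{\exp(\phi_F(x)-p|F|)}\le\exp(\epsilon|F|)$ for every $(K,\delta)$-invariant $F\in\mathcal{F}(G)$ and every $x\in X$. *)

(* Defs.v *)
From HB Require Import structures.
From mathcomp Require Import all_boot all_order all_algebra finmap.
From mathcomp Require Import all_classical all_reals all_analysis.

Set Implicit Arguments.
Unset Strict Implicit.
Unset Printing Implicit Defensive.

Import Order.TTheory GRing.Theory Num.Theory.
Import numFieldNormedType.Exports.

Local Open Scope classical_set_scope.
Local Open Scope ring_scope.

(** * Finite subsets of a group *)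

Definition fset_mul (G : groupType) (K F : {fset G}) : {fset G} :=
  [fset (k * f)%g | k in K, f in F]%fset.

Definition fset_inv (G : groupType) (F : {fset G}) : {fset G} :=
  [fset (g^-1)%g | g in F]%fset.

Definition fset_symdiff (G : groupType) (A B : {fset G}) : {fset G} :=
  ((A `\` B) `|` (B `\` A))%fset.

Definition almost_invariant (R : realType) (G : groupType) (K : {fset G})
    (delta : R) (F : {fset G}) : Prop :=
  F != fset0 /\ #|` fset_symdiff (fset_mul K F) F|%:R < delta * #|` F|%:R.

Definition amenable (R : realType) (G : groupType) : Prop :=
  forall (K : {fset G}) (delta : R), K != fset0 -> 0 < delta ->
    exists F : {fset G}, almost_invariant K delta F.

(* Convergence along this filter is the limit written F -> G: a property is
   eventually true when it holds for all (K, delta)-invariant F, for some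
   K and delta. *)
Definition folner (R : realType) (G : groupType) : set_system {fset G} :=
  [set P | exists (K : {fset G}) (delta : R),
     [/\ K != fset0, 0 < delta & forall F, almost_invariant K delta F -> P F]].
Arguments folner : clear implicits.

Definition exhausting (G : groupType) (E : nat -> {fset G}) : Prop :=
  [/\ E 0%N = fset0,
      E 1%N = [fset 1%g]%fset,
      (forall m, (E m `<` E m.+1)%fset) &
      forall g : G, exists m, g \in E m].

(** * Configurations *)

(* The underlying type is [G -> nat]; the measurable sets are the Borel sets of
   the product topology. *)
Definition config (G : groupType) :=
  g_sigma_algebraType (@open (prod_topology (fun _ : G => nat))).

Definition ccoord (G : groupType) (g : G) (x : config G) : nat := x g.

(* The generating sets of the sigma-algebra of the coordinates in D. *)
Definition coord_events (G : groupType) (D : set G) : set_system (config G) :=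
  \bigcup_(g in D) preimage_set_system setT (@ccoord G g) measurable.

Definition crestrict (G : groupType) (F : {fset G}) (x : config G) :
    {ffun F -> nat} :=
  [ffun i : F => x (val i)].

Definition ccylinder (G : groupType) (F : {fset G}) (w : {ffun F -> nat}) :
    set (config G) :=
  [set x | crestrict F x = w].

Definition csplice (G : groupType) (F : {fset G}) (w : {ffun F -> nat})
    (x : config G) : config G :=
  fun g => if insub g is Some i then w i else x g.

Definition cshift (G : groupType) (g : G) (x : config G) : config G :=
  fun h => x (h * g)%g.

(** * Potentials *)

Definition birkhoff (R : realType) (G : groupType) (phi : config G -> R)
    (F : {fset G}) (x : config G) : R :=
  \sum_(g <- F) phi (cshift g x).

(* Suprema are taken in [\bar R], the real-valued [sup] being 0 on sets that are
   not bounded above. *)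
Definition cvariation (R : realType) (G : groupType) (phi : config G -> R)
    (E : {fset G}) : \bar R :=
  ereal_sup [set r | exists x y : config G,
    crestrict E x = crestrict E y /\ r = `|phi x - phi y|%:E].

Definition summable_variation (R : realType) (G : groupType)
    (phi : config G -> R) (E : nat -> {fset G}) : Prop :=
  (\sum_(1 <= m <oo)
     #|` (fset_inv (E m.+1) `\` fset_inv (E m))%fset|%:R%:E * cvariation phi (E m)
   < +oo)%E.

Definition exp_summable (R : realType) (G : groupType) (phi : config G -> R) :
    Prop :=
  (\sum_(0 <= a <oo)
     expeR (ereal_sup [set (phi x)%:E | x in [set x | ccoord 1%g x = a]])
   < +oo)%E.

Definition partition_function (R : realType) (G : groupType)
    (phi : config G -> R) (F : {fset G}) : \bar R :=
  \esum_(w in [set: {ffun F -> nat}])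
    expeR (ereal_sup [set (birkhoff phi F x)%:E | x in ccylinder w]).

Definition pressure (R : realType) (G : groupType) (phi : config G -> R) : R :=
  lim (#|` F|%:R^-1 * ln (fine (partition_function phi F))
       @[F --> folner R G]).

(** * Gibbs measures *)

Definition gibbs_weight (R : realType) (G : groupType) (phi : config G -> R)
    (F K : {fset G}) (B : set (config G)) (x : config G) : \bar R :=
  \esum_(w in [set: {ffun K -> nat}])
    (expR (birkhoff phi F (csplice w x)) * \1_B (csplice w x))%:E.

(* The weights may be infinite while E m does not contain K, so that the first
   ratios can be meaningless; the limit does not depend on them. *)
Definition gibbs_kernel (R : realType) (G : groupType) (phi : config G -> R)
    (E : nat -> {fset G}) (K : {fset G}) (B : set (config G)) (x : config G) :
    R :=
  limn (fun m => fine (gibbs_weight phi (E m) K B x) /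
                 fine (gibbs_weight phi (E m) K setT x)).

(* f is a version of the conditional probability of B given the sigma-algebra
   of the coordinates in D. *)
Definition cond_prob (R : realType) (G : groupType)
    (mu : probability (config G) R) (D : set G) (B : set (config G))
    (f : config G -> R) : Prop :=
  [/\ measurable_fun setT (f : g_sigma_algebraType (coord_events D) -> R),
      mu.-integrable setT (EFin \o f) &
      forall A, <<s coord_events D >> A ->
        (\int[mu]_(x in A) (f x)%:E = mu (A `&` B))%E].

(* Conditional probabilities are defined up to null sets: the kernel has to agree
   almost everywhere with one version, hence with every version. *)
Definition DLR (R : realType) (G : groupType) (phi : config G -> R)
    (E : nat -> {fset G}) (mu : probability (config G) R) : Prop :=
  forall (K : {fset G}) (B : set (config G)), K != fset0 -> measurable B ->
    exists2 f : config G -> R,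
      cond_prob mu (~` [set` K]) B f &
      {ae mu, forall x, f x = gibbs_kernel phi E K B x}.

Definition bowen_gibbs (R : realType) (G : groupType) (phi : config G -> R)
    (mu : probability (config G) R) : Prop :=
  exists p : R, forall eps : R, 0 < eps ->
    exists (K : {fset G}) (delta : R),
      [/\ K != fset0, 0 < delta &
          forall (F : {fset G}) (x : config G), almost_invariant K delta F ->
            expR (- eps * #|` F|%:R)
            <= fine (mu (ccylinder (crestrict F x))) /
               expR (birkhoff phi F x - p * #|` F|%:R)
            <= expR (eps * #|` F|%:R)].

(* Main.v *)
Require Import Defs.
From HB Require Import structures.
From mathcomp Require Import all_boot all_order all_algebra finmap.
From mathcomp Require Import all_classical all_reals all_analysis.
From mathcomp Require Import measurable_realfun ring lra.

Set Implicit Arguments.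
Unset Strict Implicit.
Unset Printing Implicit Defensive.

Import Order.TTheory GRing.Theory Num.Theory.
Import numFieldNormedType.Exports.

Local Open Scope classical_set_scope.
Local Open Scope ring_scope.

(* Write [Z_F] for the partition function and call [osc_F] the total oscillation
   of the Birkhoff sums caused by the boundary of [F].  Summable variation makes
   [osc_F] at most [eps * #|F|] once [F] is invariant enough: a translate [g]
   outside of [F] only sees [F] through the coordinates beyond [E m], where [m]
   is its level, and the translates of level [m] lie in
   [(E m.+1^-1 `\` E m^-1) F].  Hence every ratio defining the kernel is
   [exp(phi_F(y)) / Z_F] up to a factor [exp(3 osc_F)], and the ratios converge
   because their logarithms have summable increments.

   It remains that [ln Z_F / #|F|] converges along Folner sets.  Finner's
   inequality (the Hoelder form of Shearer's) gives
   [k ln Z_F <= sum_i ln Z_(D i)] whenever the sets [D i] cover each point of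
   [F] exactly [k] times.  Covering [F] by the translates of a fixed [K] bounds
   the upper limit by [ln Z_K / #|K|], so the limit is the infimum over [K] and
   no quasi-tiling is needed. *)

(** * Truncated log-sum-exp over coordinates *)

Definition upd (T : eqType) (x : T -> nat) (g : T) (a : nat) : T -> nat :=
  fun h => if h == g then a else x h.

(* The sums are truncated to values at most [n], so that they are always
   finite. *)
Definition lse (R : realType) (T : eqType) (n : nat) (g : T)
    (h : (T -> nat) -> R) (x : T -> nat) : R :=
  ln (\sum_(a < n.+1) expR (h (upd x g a))).

Definition lses (R : realType) (T : eqType) (n : nat) (s : seq T)
    (h : (T -> nat) -> R) : (T -> nat) -> R :=
  foldr (lse n) h s.

Definition indep (R : Type) (T : eqType) (g : T) (h : (T -> nat) -> R) : Prop :=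
  forall x a, h (upd x g a) = h x.

Definition box (T : eqType) (n : nat) (s : seq T) (x : T -> nat) :
    set (T -> nat) :=
  [set y | {in s, forall g, (y g <= n)%N} /\ forall g, g \notin s -> y g = x g].

Section upd_theory.
Variable T : eqType.
Implicit Types (x : T -> nat) (g h : T).

Lemma upd_same x g a : upd x g a g = a.
Proof. by rewrite /upd eqxx. Qed.

Lemma upd_other x g a h : h != g -> upd x g a h = x h.
Proof. by rewrite /upd => /negbTE ->. Qed.

Lemma updC x g h a b : g != h ->
  upd (upd x g a) h b = upd (upd x h b) g a.
Proof.
move=> gh; apply/funext => k; rewrite /upd.
by have [->|//] := eqVneq k h; rewrite eq_sym (negbTE gh).
Qed.

End upd_theory.

Section lse_theory.
Variables (R : realType) (T : eqType).
Implicit Types (h : (T -> nat) -> R) (x : T -> nat) (g : T) (s : seq T).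

Lemma sum_expR_gt0 n (f : nat -> R) : 0 < \sum_(a < n.+1) expR (f a).
Proof.
rewrite big_ord_recl /=; apply: ltr_pwDl; first exact: expR_gt0.
by apply: sumr_ge0 => i _; exact: expR_ge0.
Qed.

Lemma expR_lse n g h x :
  expR (lse n g h x) = \sum_(a < n.+1) expR (h (upd x g a)).
Proof. exact/lnK/(sum_expR_gt0 n (fun a => h (upd x g a))). Qed.

Lemma le_lse n g h1 h2 x : (forall y, h1 y <= h2 y) ->
  lse n g h1 x <= lse n g h2 x.
Proof.
move=> le12; rewrite -ler_expR !expR_lse; apply: ler_sum => a _.
by rewrite ler_expR.
Qed.

Lemma lse_addl n g h1 h2 x : indep g h1 ->
  lse n g (fun y => h1 y + h2 y) x = h1 x + lse n g h2 x.
Proof.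
move=> h1g; apply: (@expR_inj R); rewrite expRD !expR_lse mulr_sumr.
by apply: eq_bigr => a _; rewrite expRD h1g.
Qed.

Lemma le_lses n s h1 h2 x : (forall y, h1 y <= h2 y) ->
  lses n s h1 x <= lses n s h2 x.
Proof. by move=> le12; elim: s x => //= g s IH x; exact: le_lse. Qed.

Lemma indep_lse n g g' h : g != g' -> indep g h -> indep g (lse n g' h).
Proof.
by move=> gg' hg x a; congr ln; apply: eq_bigr => b _; rewrite updC ?hg.
Qed.

Lemma indep_lses n g s h : g \notin s -> indep g h -> indep g (lses n s h).
Proof.
elim: s => //= g' s IH; rewrite inE negb_or => /andP[gg' gs] hg.
by apply: indep_lse => //; exact: IH.
Qed.

(** Jensen's inequality for the exponential: its graph lies above the tangent line at the mean [m],
    and the linear terms cancel in the sum. *)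
Lemma expR_mean (I : Type) (r : seq I) (t : I -> R) : (0 < size r)%N ->
  (size r)%:R * expR ((size r)%:R^-1 * \sum_(i <- r) t i)
  <= \sum_(i <- r) expR (t i).
Proof.
move=> r0; set k := (size r)%:R; set m := k^-1 * _.
have k0 : k != 0 :> R by rewrite pnatr_eq0 -lt0n.
have -> : k * expR m = \sum_(i <- r) expR m * (1 + (t i - m)).
  rewrite -mulr_sumr big_split sumrB /= !big_const_seq !count_predT !iter_addr_0.
  rewrite mulrC -[m *+ _]mulr_natr -/k; congr (_ * _).
  by rewrite /m [_ * k]mulrC mulrA mulfV// mul1r subrr addr0.
apply: ler_sum => i _.
rewrite -[in leRHS](subrK m (t i)) expRD mulrC ler_wpM2r ?expR_ge0//.
exact: expR_ge1Dx.
Qed.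

(** Hölder's inequality with equal exponents. Once each [h i] is normalized by its own [lse], its
    exponentials sum to 1 over [a], so AM-GM at each [a] gives a total of at most 1. *)
Lemma lse_mean n g (I : Type) (r : seq I) (h : I -> (T -> nat) -> R) x :
  (0 < size r)%N ->
  lse n g (fun y => (size r)%:R^-1 * \sum_(i <- r) h i y) x
  <= (size r)%:R^-1 * \sum_(i <- r) lse n g (h i) x.
Proof.
move=> r0; set k : R := (size r)%:R.
have k0 : 0 < k by rewrite ltr0n.
set L := k^-1 * _; rewrite -ler_expR expR_lse.
rewrite -[leRHS]mul1r -ler_pdivrMr ?expR_gt0//.
rewrite mulr_suml.
rewrite (_ : \sum_(a < _) _ = \sum_(a < n.+1)
    expR (k^-1 * \sum_(i <- r) (h i (upd x g a) - lse n g (h i) x))); last first.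
  apply: eq_bigr => a _; rewrite -expRN -expRD; congr expR.
  by rewrite sumrB mulrBr.
rewrite -(ler_pM2l k0) mulr_sumr.
apply: (@le_trans _ _
    (\sum_(a < n.+1) \sum_(i <- r) expR (h i (upd x g a) - lse n g (h i) x))).
  by apply: ler_sum => a _; exact: expR_mean.
rewrite exchange_big/= mulr1.
rewrite (eq_bigr (fun=> 1)); last first.
  move=> i _; under eq_bigr do rewrite expRD expRN.
  by rewrite -mulr_suml -expR_lse divff// gt_eqF ?expR_gt0.
by rewrite big_const_seq count_predT iter_addr_0.
Qed.

(* Finner's generalization of Shearer's inequality, in logarithmic form. *)
Lemma lses_uniform_cover n k s (I : Type) (r : seq I) (D : I -> pred T)
    (h : I -> (T -> nat) -> R) x :
  (0 < k)%N -> uniq s ->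
  {in s, forall g, count (fun i => D i g) r = k} ->
  (forall i g, ~~ D i g -> indep g (h i)) ->
  lses n s (fun y => k%:R^-1 * \sum_(i <- r) h i y) x
  <= k%:R^-1 * \sum_(i <- r) lses n [seq g <- s | D i g] (h i) x.
Proof.
move=> k0; elim: s x => [|g s IH] x /=.
  by move=> *; exact: lexx.
move=> /andP[gs us] cov ind.
set H := fun i y => lses n [seq g <- s | D i g] (h i) y.
apply: (@le_trans _ _ (lse n g (fun y => k%:R^-1 * \sum_(i <- r) H i y) x)).
  apply: le_lse => y; apply: IH => // g' g's.
  by apply: cov; rewrite inE g's orbT.
have Hg i : ~~ D i g -> indep g (H i).
  move=> Dg; apply: indep_lses; last exact: ind.
  by rewrite mem_filter (negbTE gs) andbF.
(* Members whose set misses [g] do not depend on that coordinate and come out of the [lse]. Exactly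
   [k] members remain, so the prefactor is the reciprocal of their number and Hölder applies. *)
set r1 := [seq i <- r | D i g].
have sr1 : size r1 = k by rewrite size_filter cov// mem_head.
have split y : k%:R^-1 * \sum_(i <- r) H i y =
    k%:R^-1 * \sum_(i <- r | ~~ D i g) H i y
    + (size r1)%:R^-1 * \sum_(i <- r1) H i y.
  by rewrite sr1 big_filter (bigID (fun i => D i g))/= mulrDr addrC.
rewrite (_ : (fun y => _) = (fun y => k%:R^-1 * \sum_(i <- r | ~~ D i g) H i y
    + (size r1)%:R^-1 * \sum_(i <- r1) H i y)); last exact/funext.
rewrite lse_addl; last first.
  by move=> y a; congr (_ * _); apply: eq_bigr => i /Hg ->.
apply: le_trans (lerD (lexx _) (lse_mean _ _ _ _ _)) _.
  by rewrite sr1.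
rewrite sr1 -mulrDr ler_wpM2l ?invr_ge0 ?ler0n//.
rewrite big_filter [leRHS](bigID (fun i => D i g))/= addrC.
apply: lerD; first by apply: ler_sum => i /negbTE; rewrite /H => ->.
by apply: ler_sum => i ->.
Qed.

End lse_theory.

(** * Truncated sums compared with sums over all configurations *)

Section lses_esum.
Variables (R : realType) (T : choiceType).
Implicit Types (h : (T -> nat) -> R) (x : T -> nat) (s : seq T).

Lemma box_cons n g s x : g \notin s ->
  box n (g :: s) x = \bigcup_(a in `I_n.+1) box n s (upd x g a).
Proof.
move=> gs; apply/seteqP; split => y /=.
  move=> [yn yx]; exists (y g) => /=.
    by rewrite ltnS; apply: yn; exact: mem_head.
  split=> [k ks|k ks]; first by rewrite yn// inE ks orbT.
  have [->|kg] := eqVneq k g; first by rewrite upd_same.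
  by rewrite upd_other// yx// inE negb_or kg.
move=> [a /= an [yn yx]]; split=> [k|k].
  rewrite inE => /predU1P[->|]; last exact: yn.
  by rewrite yx// upd_same.
by rewrite inE negb_or => /andP[kg ks]; rewrite yx// upd_other.
Qed.

(** The box is the disjoint union over the value at the first coordinate, so peeling off coordinates
    matches the nesting of [lses]. *)
Lemma esum_box n s h x : uniq s ->
  \esum_(y in box n s x) (expR (h y))%:E = (expR (lses n s h x))%:E.
Proof.
elim: s x => [|g s IH] x /=.
  move=> _; rewrite (_ : box n [::] x = [set x]).
    by rewrite esum_set1// lee_fin expR_ge0.
  apply/seteqP; split => [y [_ yx]|y ->] //=.
  by apply/funext => k; rewrite yx.
move=> /andP[gs us]; rewrite box_cons// esum_bigcup; last 2 first.
  - move=> a b _ _ [y [[_ ya] [_ yb]]].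
    by have := yb _ gs; rewrite ya// !upd_same.
  - by move=> y _; rewrite lee_fin expR_ge0.
rewrite (eq_esum (b := fun a => (expR (lses n s h (upd x g a)))%:E)); last first.
  by move=> a _; exact: IH.
rewrite esum_fset; last 2 first.
- exact: finite_II.
- by move=> a _; rewrite lee_fin expR_ge0.
by rewrite -fsbig_ord sumEFin -expR_lse.
Qed.

Lemma esum_subset (U : choiceType) (A B : set U) (a : U -> \bar R) :
  A `<=` B -> (\esum_(i in A) a i <= \esum_(i in B) a i)%E.
Proof.
move=> AB; apply: ereal_sup_le => _ [X [finX XA] <-].
by exists X => //; split => //; exact: subset_trans AB.
Qed.

End lses_esum.

(** * Partition functions *)

Section config_theory.
Variable G : groupType.
Implicit Types (F : {fset G}) (x y : config G).

Lemma crestrictP F x y :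
  crestrict F x = crestrict F y <-> {in F, forall g, x g = y g}.
Proof.
split=> [/ffunP xy g gF|xy].
  by have := xy [` gF]%fset; rewrite !ffunE.
by apply/ffunP => i; rewrite !ffunE; exact/xy/valP.
Qed.

Lemma csplice_in F (w : {ffun F -> nat}) x g (gF : g \in F) :
  csplice w x g = w [` gF]%fset.
Proof. by rewrite /csplice insubT. Qed.

Lemma csplice_out F (w : {ffun F -> nat}) x g : g \notin F ->
  csplice w x g = x g.
Proof. by move=> gF; rewrite /csplice insubN. Qed.

Lemma crestrict_csplice F (w : {ffun F -> nat}) x : crestrict F (csplice w x) = w.
Proof.
apply/ffunP => i; rewrite ffunE (csplice_in _ _ (valP i)); congr (w _).
exact: val_inj.
Qed.

Lemma csplice_crestrict F x y : (forall g, g \notin F -> y g = x g) ->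
  csplice (crestrict F y) x = y.
Proof.
move=> yx; apply/funext => g; have [gF|gF] := boolP (g \in F).
  by rewrite csplice_in ffunE.
by rewrite csplice_out// yx.
Qed.

End config_theory.

Section splice_esum.
Variables (R : realType) (G : groupType) (F : {fset G}).
Implicit Types (h : (G -> nat) -> R) (x : G -> nat) (s : seq G).

Lemma esum_csplice (a : (G -> nat) -> \bar R) x :
  \esum_(w in [set: {ffun F -> nat}]) a (csplice w x) =
  \esum_(y in [set y : G -> nat | forall g, g \notin F -> y g = x g]) a y.
Proof.
rewrite (@reindex_esum _ _ _ [set: {ffun F -> nat}] _
  (fun w => (csplice w x : G -> nat)))//.
split=> [w _ g|w w' _ _ ww'|y yx]; first exact: csplice_out.
- by rewrite -[w](crestrict_csplice w x) ww' crestrict_csplice.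
- by exists (crestrict F y) => //; exact: csplice_crestrict.
Qed.

Lemma lses_le_esum_csplice n s h x : uniq s -> s =i F ->
  ((expR (lses n s h x))%:E
   <= \esum_(w in [set: {ffun F -> nat}]) (expR (h (csplice w x)))%:E)%E.
Proof.
move=> us sF; rewrite (esum_csplice (fun y => (expR (h y))%:E)) -esum_box//.
by apply: esum_subset => y [_ yx] g gF; apply: yx; rewrite sF.
Qed.

(** A sum of non-negative terms is the supremum of its finite subsums, and finitely many
    configurations equal to [x] off [F] lie in one box, with side their largest value on [F]. *)
Lemma esum_csplice_le s h x c : uniq s -> s =i F ->
  (forall n, lses n s h x <= c) ->
  (\esum_(w in [set: {ffun F -> nat}]) (expR (h (csplice w x)))%:E
   <= (expR c)%:E)%E.
Proof.
move=> us sF hc; rewrite (esum_csplice (fun y => (expR (h y))%:E)).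
apply: ge_ereal_sup => _ [X [finX Xx] <-].
pose n := \max_(y <- fset_set X) \max_(g <- F) y g.
apply: (@le_trans _ _ (\esum_(y in box n s x) (expR (h y))%:E)).
  apply: esum_ge; exists X => //; split=> // y Xy; split=> [g|g].
    rewrite sF => gF; apply: (@leq_trans (\max_(g <- F) y g)).
      by rewrite (big_rem g)//= leq_maxl.
    by rewrite /n (big_rem y)/= ?leq_maxl// in_fset_set// inE.
  by rewrite sF => gF; exact: Xx.
by rewrite esum_box// lee_fin ler_expR.
Qed.

End splice_esum.

Section partition.
Variables (R : realType) (G : groupType) (phi : config G -> R).
Hypothesis phi_exp : exp_summable phi.
Implicit Types (F : {fset G}) (x y : config G).

Definition head_sup (a : nat) : R :=
  fine (ereal_sup [set (phi x)%:E | x in [set x | ccoord 1%g x = a]]).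

(** The supremum over the cylinder of [x] is made a function of the whole configuration, so that
    coordinatewise [lse] can act on it. *)
Definition cell_sup F (x : config G) : R :=
  sup [set birkhoff phi F y | y in [set y | crestrict F y = crestrict F x]].

Definition log_partition F : R := ln (fine (partition_function phi F)).

(** An infinite supremum would make a term of the convergent series in [exp_summable] infinite; a
    constant configuration excludes minus infinity. *)
Lemma head_supE a :
  (head_sup a)%:E = ereal_sup [set (phi x)%:E | x in [set x | ccoord 1%g x = a]].
Proof.
rewrite /head_sup fineK// fin_numE; apply/andP; split.
  rewrite -ltNye.
  apply: (@lt_le_trans _ _ (phi (fun=> a))%:E); first exact: ltNyr.
  by apply: ereal_sup_ubound; exists (fun=> a).
apply/negP => /eqP aoo; move: phi_exp.
rewrite /exp_summable ltNge => /negP; apply.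
rewrite leye_eq; apply/eqP/(@nneseries_pinfty _ _ _ a) => //.
  by move=> *; exact: expeR_ge0.
by rewrite aoo.
Qed.

Definition head_sum : R := fine (\sum_(0 <= a <oo) (expR (head_sup a))%:E)%E.

Lemma head_sum_ge n : \sum_(a < n) expR (head_sup a) <= head_sum.
Proof.
have sum_ge0 : (0 <= \sum_(0 <= a <oo) (expR (head_sup a))%:E)%E.
  by apply: nneseries_ge0 => a _ _; rewrite lee_fin expR_ge0.
have sum_fin : (\sum_(0 <= a <oo) (expR (head_sup a))%:E)%E \is a fin_num.
  rewrite ge0_fin_numE//; move: phi_exp; rewrite /exp_summable.
  by under eq_eseriesr do rewrite -head_supE.
rewrite -lee_fin /head_sum fineK// -sumEFin.
rewrite -(big_mkord xpredT (fun a => (expR (head_sup a))%:E)).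
by apply: nneseries_lim_ge => a _ _; rewrite lee_fin expR_ge0.
Qed.

Lemma le_head_sup x : phi x <= head_sup (x 1%g).
Proof. by rewrite -lee_fin head_supE; apply: ereal_sup_ubound; exists x. Qed.

Lemma birkhoff_le_head F x : birkhoff phi F x <= \sum_(g <- F) head_sup (x g).
Proof.
apply: ler_sum => g _; apply: le_trans (le_head_sup _) _.
by rewrite /cshift mul1g.
Qed.

(** The real [sup] is meaningful here: the sum of [head_sup (x g)] over [F] bounds the Birkhoff sums
    on the whole cell. *)
Lemma birkhoff_le_cell_sup F x y : crestrict F y = crestrict F x ->
  birkhoff phi F y <= cell_sup F x.
Proof.
move=> yx; apply: ub_le_sup; last by exists y.
exists (\sum_(g <- F) head_sup (x g)) => _ [z /= /crestrictP zx <-].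
apply: le_trans (birkhoff_le_head _ _) _.
by rewrite le_eqVlt; apply/orP; left; apply/eqP/eq_big_seq => g /zx ->.
Qed.

Lemma cell_sup_le F x c :
  (forall y, crestrict F y = crestrict F x -> birkhoff phi F y <= c) ->
  cell_sup F x <= c.
Proof.
move=> hc; apply: ge_sup; first by exists (birkhoff phi F x); exists x.
by move=> _ [y /= yx <-]; exact: hc.
Qed.

Lemma eq_cell_sup F x y : crestrict F x = crestrict F y ->
  cell_sup F x = cell_sup F y.
Proof. by rewrite /cell_sup => ->. Qed.

Lemma indep_cell_sup F g : g \notin F -> indep g (cell_sup F).
Proof.
move=> gF x a; apply: eq_cell_sup; apply/crestrictP => h hF.
by rewrite upd_other//; apply: contraNneq gF => <-.
Qed.

(** The background [x] is arbitrary because [cell_sup F] only sees the coordinates in [F]. *)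
Lemma partition_functionE F x : partition_function phi F =
  \esum_(w in [set: {ffun F -> nat}]) (expR (cell_sup F (csplice w x)))%:E.
Proof.
apply: eq_esum => w _; rewrite /cell_sup crestrict_csplice.
rewrite -(image_comp (birkhoff phi F) EFin) ereal_sup_EFin//.
  exists (cell_sup F (csplice w x)) => _ [y /= yw <-].
  by apply: birkhoff_le_cell_sup; rewrite crestrict_csplice.
by exists (birkhoff phi F (csplice w x)); exists (csplice w x) => //=;
  exact: crestrict_csplice.
Qed.

(** Each point of [F] is counted [k] times, so [k] times the Birkhoff sum over [F] is the sum of
    those over the [D i]. The supremum of a sum is at most the sum of the suprema, and Finner's
    inequality does the rest. *)
Lemma lses_cell_sup_cover n k F (I : eqType) (r : seq I) (D : I -> {fset G}) x :
  (0 < k)%N -> {in r, forall i, D i `<=` F}%fset ->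
  {in F, forall g, count (fun i => g \in D i) r = k} ->
  k%:R * lses n F (cell_sup F) x
  <= \sum_(i <- r) lses n [seq g <- F | g \in D i] (cell_sup (D i)) x.
Proof.
move=> k0 DF cov.
have k0R : 0 < k%:R :> R by rewrite ltr0n.
rewrite -ler_pdivlMl//.
apply: le_trans _
  (lses_uniform_cover (D := fun i g => g \in D i) n x k0 _ cov _).
- apply: le_lses => y.
  apply: cell_sup_le => z zy; rewrite ler_pdivlMl//.
  have -> : k%:R * birkhoff phi F z = \sum_(i <- r) birkhoff phi (D i) z.
    rewrite [RHS]big_seq.
    rewrite (eq_bigr (fun i => \sum_(g <- F | g \in D i) phi (cshift g z))).
      rewrite -big_seq (exchange_big_dep xpredT)//= /birkhoff mulr_sumr.
      apply: eq_big_seq => g gF.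
      by rewrite big_const_seq cov// iter_addr_0 mulr_natl.
    move=> i /DF /fsubsetP DiF; rewrite /birkhoff -[RHS]big_filter.
    apply: perm_big.
    apply: uniq_perm; rewrite ?filter_uniq ?fset_uniq// => g.
    by rewrite mem_filter andb_idr// => /DiF.
  rewrite !big_seq; apply: ler_sum => i /DF /fsubsetP DiF.
  apply: birkhoff_le_cell_sup.
  by move/crestrictP: zy => zy; apply/crestrictP => g /DiF/zy.
- exact: fset_uniq.
- by move=> i g; exact: indep_cell_sup.
Qed.

(** The cover by singletons, with [k = 1], reduces to one coordinate, where [head_sum] bounds the
    sum. The bound is uniform in the truncation [n]. *)
Lemma lses_cell_sup_le n F x :
  lses n F (cell_sup F) x <= #|` F|%:R * ln head_sum.
Proof.
rewrite -[leLHS]mul1r.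
apply: le_trans (lses_cell_sup_cover (k := 1%N) (r := F)
  (D := fun g => [fset g]%fset) n x _ _ _) _ => //.
- by move=> g gF; rewrite fsub1set.
- move=> g gF; rewrite (eq_count (a2 := pred1 g)).
    by rewrite count_uniq_mem ?gF ?fset_uniq.
  by move=> h; rewrite /= inE eq_sym.
- have -> : #|` F|%:R * ln head_sum = \sum_(g <- F) ln head_sum.
    by rewrite big_const_seq count_predT iter_addr_0 mulr_natl.
  rewrite big_seq [leRHS]big_seq.
  apply: ler_sum => g gF.
  rewrite (eq_filter (a2 := pred1 g)); last by move=> h; rewrite /= inE.
  rewrite filter_pred1_uniq ?fset_uniq//=.
  rewrite -ler_expR expR_lse lnK ?posrE; last first.
    by apply: lt_le_trans (head_sum_ge 1); exact: (sum_expR_gt0 0 head_sup).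
  apply: le_trans (head_sum_ge n.+1); apply: ler_sum => a _; rewrite ler_expR.
  apply: cell_sup_le => y /crestrictP yg.
  apply: le_trans (birkhoff_le_head _ _) _.
  by rewrite big_seq_fset1 yg ?inE// upd_same.
Qed.

(** Finiteness comes from the uniform bound on truncated sums, positivity from the truncation at 0;
    hence [ln] and [fine] take no default values here. *)
Lemma partition_functionK F :
  partition_function phi F = (expR (log_partition F))%:E.
Proof.
have le_pf := lses_le_esum_csplice 0 (cell_sup F) (fun=> 0%N)
  (fset_uniq F) (fun=> erefl).
have pf_le := @esum_csplice_le _ _ F F (cell_sup F) (fun=> 0%N) _
  (fset_uniq F) (fun=> erefl) (fun n => lses_cell_sup_le n F _).
have pf_fin : partition_function phi F \is a fin_num.
  rewrite ge0_fin_numE ?(partition_functionE _ (fun=> 0%N)).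
    exact: le_lt_trans pf_le (ltry _).
  by apply: esum_ge0 => w _; rewrite lee_fin expR_ge0.
rewrite /log_partition lnK ?fineK// posrE -lte_fin fineK//.
rewrite (partition_functionE _ (fun=> 0%N)).
by apply: lt_le_trans le_pf; rewrite lte_fin expR_gt0.
Qed.

Lemma lses_le_log_partition n s F x : uniq s -> s =i F ->
  lses n s (cell_sup F) x <= log_partition F.
Proof.
move=> us sF; rewrite -ler_expR -lee_fin -partition_functionK.
by rewrite (partition_functionE _ x); exact: lses_le_esum_csplice.
Qed.

Lemma log_partition_le s F x c : uniq s -> s =i F ->
  (forall n, lses n s (cell_sup F) x <= c) -> log_partition F <= c.
Proof.
move=> us sF hc; rewrite -ler_expR -lee_fin -partition_functionK.
by rewrite (partition_functionE _ x); exact: (esum_csplice_le us sF hc).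
Qed.

(** The truncated inequality holds for every [n], and its right side is bounded independently of
    [n], so it passes to the full sums. *)
Lemma log_partition_cover k F (I : eqType) (r : seq I) (D : I -> {fset G}) :
  (0 < k)%N -> {in r, forall i, D i `<=` F}%fset ->
  {in F, forall g, count (fun i => g \in D i) r = k} ->
  k%:R * log_partition F <= \sum_(i <- r) log_partition (D i).
Proof.
move=> k0 DF cov; have k0R : 0 < k%:R :> R by rewrite ltr0n.
rewrite -ler_pdivlMl//.
apply: (log_partition_le (x := fun=> 0%N) (fset_uniq F)) => // n.
 rewrite ler_pdivlMl//.
apply: le_trans (lses_cell_sup_cover _ _ k0 DF cov) _.
rewrite !big_seq; apply: ler_sum => i /DF /fsubsetP DiF.
apply: lses_le_log_partition; first by rewrite filter_uniq ?fset_uniq.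
by move=> g; rewrite mem_filter andb_idr// => /DiF.
Qed.

Lemma birkhoff_le_log_partition F x : birkhoff phi F x <= log_partition F.
Proof.
rewrite -ler_expR -lee_fin -partition_functionK (partition_functionE _ x).
apply: esum_ge; exists [set crestrict F x].
  by split => //; exact: finite_set1.
rewrite fsbig_set1 lee_fin ler_expR csplice_crestrict//.
exact: birkhoff_le_cell_sup.
Qed.

(** The Birkhoff sum over [F g] at [y] is the one over [F] at [cshift g y], so shifting the
    configuration carries the cells over [F g] to cells over [F]. *)
Lemma log_partition_shift_le F g :
  log_partition [fset (f * g)%g | f in F]%fset <= log_partition F.
Proof.
have gI : injective (fun f : G => (f * g)%g) by exact: mulIg.
apply: (@log_partition_le [seq (f * g)%g | f <- F] _ (fun=> 0%N)) => //.
- by rewrite (map_inj_uniq gI) fset_uniq.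
- move=> h; apply/mapP/imfsetP => /= -[f fF ->]; by exists f.
move=> n.
have shift_upd x f a : cshift g (upd x (f * g)%g a) = upd (cshift g x) f a.
  by apply/funext => h; rewrite /cshift /upd (inj_eq gI).
have lses_shift s h x : lses n [seq (f * g)%g | f <- s] (h \o cshift g) x =
    lses n s h (cshift g x).
  elim: s x => //= f s IH x; congr ln; apply: eq_bigr => a _.
  by rewrite IH shift_upd.
have cell_shift x : cell_sup [fset (f * g)%g | f in F]%fset x <=
    (cell_sup F \o cshift g) x.
  apply: cell_sup_le => y /crestrictP yx.
  rewrite (_ : birkhoff _ _ _ = birkhoff phi F (cshift g y)).
    apply: birkhoff_le_cell_sup; apply/crestrictP => f fF.
    by apply: yx; apply/imfsetP; exists f.
  rewrite /birkhoff big_imfset/=; last by move=> ? ? _ _; exact: gI.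
  apply: eq_bigr => f _; congr phi; apply/funext => h.
  by rewrite /cshift mulgA.
apply: le_trans (le_lses _ _ _ cell_shift) _.
rewrite lses_shift; apply: lses_le_log_partition => //; exact: fset_uniq.
Qed.

End partition.

(** * Folner sets and the pressure *)

Section fset_mul_theory.
Variable G : groupType.
Implicit Types (A B K F : {fset G}) (g : G).

Lemma mem_fset_mul K F k f : k \in K -> f \in F -> (k * f)%g \in fset_mul K F.
Proof. by move=> kK fF; apply/imfset2P; exists k => //; exists f. Qed.

Lemma mem_fset_inv K k : k \in K -> (k^-1)%g \in fset_inv K.
Proof. by move=> kK; apply/imfsetP; exists k. Qed.

Lemma fset_mulSl A B F : (A `<=` B -> fset_mul A F `<=` fset_mul B F)%fset.
Proof.
move=> /fsubsetP AB; apply/fsubsetP => _ /imfset2P[a aA [f fF ->]].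
by apply: mem_fset_mul => //; exact: AB.
Qed.

Lemma card_fset_mul_le A B : (#|` fset_mul A B| <= #|` A| * #|` B|)%N.
Proof.
apply: (@leq_trans (size [seq (a * b)%g | a <- A, b <- B])).
  apply: uniq_leq_size; first exact: fset_uniq.
  move=> _ /imfset2P[a aA [b bB ->]].
  by apply/allpairsP; exists (a, b); split.
by rewrite size_allpairs.
Qed.

Lemma card_fset_inv A : #|` fset_inv A| = #|` A|.
Proof. by rewrite card_imfset//; exact: invg_inj. Qed.

Lemma card_fset_mul_ge K F : K != fset0 -> (#|` F| <= #|` fset_mul K F|)%N.
Proof.
move=> /fset0Pn[k kK].
have <- : #|` [fset (k * f)%g | f in F]%fset| = #|` F|.
  by rewrite card_imfset//; exact: mulgI.
apply: fsubset_leq_card; apply/fsubsetP => _ /imfsetP[f fF ->].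
exact: mem_fset_mul.
Qed.

(** Since [K F] has at least as many points as [F], the part of [F] that is lost is no larger than
    the part that is gained. *)
Lemma card_symdiff_mul_le K F : K != fset0 ->
  (#|` fset_symdiff (fset_mul K F) F| <= 2 * #|` fset_mul K F `\` F|%fset)%N.
Proof.
move=> K0; rewrite cardfsU; apply: leq_trans (leq_subr _ _) _.
rewrite mul2n -addnn leq_add2l -(leq_add2l #|` fset_mul K F `&` F|%fset).
by rewrite [in leqLHS]fsetIC !cardfsID card_fset_mul_ge.
Qed.

(** If [k * g] leaves [F] while [g] is in [K^-1 F], then [k * g] is a point of [K K^-1 F] outside
    [F], and [g] is recovered by applying [k^-1]. *)
Lemma card_boundary_le K F (s : seq G) : uniq s ->
  {subset s <= fset_mul (fset_inv K) F} ->
  (count (fun g => ~~ all (fun k => (k * g)%g \in F) K) s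
   <= #|` K| * #|` fset_mul (fset_mul K (fset_inv K)) F `\` F|%fset)%N.
Proof.
move=> us sKF; rewrite -(card_fset_inv K).
apply: leq_trans (card_fset_mul_le _ _).
rewrite -size_filter; apply: uniq_leq_size; first by rewrite filter_uniq.
move=> g; rewrite mem_filter => /andP[/allPn[k kK kgF] /sKF].
move=> /imfset2P[k' k'K [f fF gE]].
rewrite -(mulKg k g); apply: mem_fset_mul; first exact: mem_fset_inv.
rewrite inE kgF/= gE mulgA; apply: mem_fset_mul => //.
exact: mem_fset_mul.
Qed.

End fset_mul_theory.

Section folner_theory.
Variables (R : realType) (G : groupType).

Lemma folner_boundary (K : {fset G}) (delta : R) : 0 < delta ->
  \forall F \near folner R G,
    F != fset0 /\ #|` fset_mul K F `\` F|%fset%:R <= delta * #|` F|%:R.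
Proof.
move=> d0; exists (1%g |` K)%fset, delta; split => //.
  by apply/fset0Pn; exists 1%g; rewrite in_fset1U eqxx.
move=> F [F0 FK]; split=> //; apply: le_trans (ltW FK); rewrite ler_nat.
apply: fsubset_leq_card; rewrite fsubsetU//; apply/orP; left.
by apply: fsetSD; apply: fset_mulSl; exact: fsubsetU1.
Qed.

Lemma folner_filter : Filter (folner R G).
Proof.
split.
- exists [fset 1%g]%fset, 1; split=> //.
  by apply/fset0Pn; exists 1%g; rewrite inE.
- move=> P Q [K [d [K0 d0 KP]]] [L [e [L0 e0 LQ]]].
  (* Invariance under the union need not pass to [K] with the same constant, since [F] minus [K F]
     may grow. By [card_symdiff_mul_le] the loss is at most a factor 2, hence the half. *)
  exists (K `|` L)%fset, (Num.min d e / 2); split.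
  + by move: K0 => /fset0Pn[k kK]; apply/fset0Pn; exists k; rewrite inE kK.
  + by rewrite divr_gt0// lt_min d0 e0.
  move=> F [F0 FKL].
  have step (A : {fset G}) c : A != fset0 -> (A `<=` K `|` L)%fset ->
      Num.min d e <= c -> almost_invariant A c F.
    move=> A0 AKL cle; split => //.
    apply: (@le_lt_trans _ _ (2 * #|` fset_mul (K `|` L) F `\` F|%fset%:R)).
      rewrite -natrM ler_nat; apply: leq_trans (card_symdiff_mul_le _ A0) _.
      rewrite leq_mul2l/=; apply: fsubset_leq_card.
      by apply: fsetSD; exact: fset_mulSl.
    apply: (@lt_le_trans _ _ (Num.min d e * #|` F|%:R)).
      rewrite mulrC -ltr_pdivlMr// mulrAC; apply: le_lt_trans FKL.
      by rewrite ler_nat fsubset_leq_card// fsubsetUl.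
    by rewrite ler_wpM2r.
  split; first by apply: KP; apply: step => //; [exact: fsubsetUl|
    rewrite ge_min lexx].
  by apply: LQ; apply: step => //; [exact: fsubsetUr|
    rewrite ge_min lexx orbT].
- move=> P Q PQ [K [d [K0 d0 KP]]]; exists K, d; split=> // F /KP.
  exact: PQ.
Qed.

Lemma folner_proper : amenable R G -> ProperFilter (folner R G).
Proof.
move=> am; apply: Build_ProperFilter_ex; last exact: folner_filter.
by move=> P [K [d [K0 d0 KP]]]; have [F /KP] := am K d K0 d0; exists F.
Qed.

End folner_theory.

#[local] Existing Instance folner_filter.

(** * Convergence of the normalized log-partition function *)

Section pressure_limit.
Variables (R : realType) (G : groupType) (phi : config G -> R).
Hypothesis phi_exp : exp_summable phi.
Implicit Types (F K : {fset G}).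

Lemma log_partition_le_card F :
  log_partition phi F <= #|` F|%:R * ln (head_sum phi).
Proof.
apply: (log_partition_le phi_exp (x := fun=> 0%N) (fset_uniq F)) => // n.
exact: lses_cell_sup_le.
Qed.

(** The sets [K g] cut down to [F], for [g] in [K^-1 F], cover [F] uniformly. A translate inside [F]
    contributes at most [log_partition phi K]; each of the few boundary translates contributes at
    most [#|K| * c]. *)
Lemma log_partition_cover_translates K F (c : R) : K != fset0 ->
  0 <= c -> ln (head_sum phi) <= c ->
  log_partition phi F <= #|` F|%:R * (#|` K|%:R^-1 * log_partition phi K)
    + #|` fset_mul (fset_mul K (fset_inv K)) F `\` F|%fset%:R
      * (`|log_partition phi K| + #|` K|%:R * c).
Proof.
move=> K0 c0 hc.
set bad := #|` fset_mul (fset_mul K (fset_inv K)) F `\` F|%fset.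
have k0 : (0 < #|` K|)%N by rewrite cardfs_gt0.
have k0R : 0 < #|` K|%:R :> R by rewrite ltr0n.
pose T := fset_mul (fset_inv K) F.
pose inside g := all (fun k => (k * g)%g \in F) K.
pose D g := ([fset (k * g)%g | k in K] `&` F)%fset.
(* The translates containing [f] are those with [g = k^-1 * f], one for each [k] in [K]. *)
have cov : {in F, forall f, count (fun g => f \in D g) T = #|` K|}.
  move=> f fF; rewrite -size_filter.
  rewrite -(size_map (fun k => (k^-1 * f)%g) K); apply/perm_size/uniq_perm.
  - by rewrite filter_uniq ?fset_uniq.
  - by rewrite map_inj_uniq ?fset_uniq// => k l /mulIg/invg_inj.
  move=> g; rewrite mem_filter; apply/andP/mapP => [[]|[k kK ->]].
    rewrite inE fF andbT => /imfsetP[k kK ->] _; exists k => //.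
    by rewrite mulKg.
  split; last by apply: mem_fset_mul => //; exact: mem_fset_inv.
  by rewrite inE fF andbT; apply/imfsetP; exists k; rewrite ?mulVKg.
have inside_le : (count inside T <= #|` F|)%N.
  have /fset0Pn[k kK] := K0.
  rewrite -size_filter -(size_map (fun g => (k * g)%g)).
  apply: uniq_leq_size.
    by rewrite map_inj_uniq ?filter_uniq ?fset_uniq//; exact: mulgI.
  move=> _ /mapP[g gT ->]; move: gT.
  by rewrite mem_filter => /andP[/allP/(_ _ kK)].
have T_ge : (#|` F| <= count inside T + count (predC inside) T)%N.
  by rewrite count_predC card_fset_mul_ge// -cardfs_gt0 card_fset_inv.
have bad_ge : (count (predC inside) T <= #|` K| * bad)%N.
  exact: (card_boundary_le (fset_uniq T)).
set a := log_partition phi K.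
have sum_le : \sum_(g <- T) log_partition phi (D g) <=
    (count inside T)%:R * a + (count (predC inside) T)%:R * (#|` K|%:R * c).
  rewrite (bigID inside)/=; apply: lerD.
    rewrite mulr_natl -iter_addr_0 -big_const_seq.
    apply: ler_sum => g /allP gin.
    rewrite (_ : D g = [fset (k * g)%g | k in K]%fset).
      exact: log_partition_shift_le.
    by apply/fsetIidPl/fsubsetP => _ /imfsetP[k kK ->]; exact: gin.
  rewrite mulr_natl -iter_addr_0 -big_const_seq.
  apply: ler_sum => g _; apply: le_trans (log_partition_le_card _) _.
  apply: (@le_trans _ _ (#|` D g|%:R * c)); first by rewrite ler_wpM2l.
  rewrite ler_wpM2r// ler_nat.
  apply: leq_trans (fsubset_leq_card (fsubsetIl _ _)) _.
  by rewrite card_imfset//; exact: mulIg.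
(* The number of inner translates differs from [#|F|] by at most the number of boundary ones; the
   absolute value covers both signs of [a]. *)
have good_le : (count inside T)%:R * a <=
    #|` F|%:R * a + (count (predC inside) T)%:R * `|a|.
  have : (count inside T)%:R <= #|` F|%:R :> R by rewrite ler_nat.
  have : #|` F|%:R <= (count inside T)%:R + (count (predC inside) T)%:R :> R.
    by rewrite -natrD ler_nat.
  move: (count inside T)%:R (count (predC inside) T)%:R => u v.
  have := ler_norm a; have := ler_norm (- a); rewrite normrN.
  by move=> *; nra.
have DF : {in T, forall g, D g `<=` F}%fset by move=> g _; exact: fsubsetIr.
have := log_partition_cover phi_exp k0 DF cov.
rewrite -/a.
have : (count (predC inside) T)%:R <= #|` K|%:R * bad%:R :> R.
  by rewrite -natrM ler_nat.
move=> bad_le cover_le; rewrite -(ler_pM2l k0R) mulrDr.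
have -> : #|` K|%:R * (#|` F|%:R * (#|` K|%:R^-1 * a)) = #|` F|%:R * a.
  by rewrite mulrCA mulVKf ?gt_eqF.
apply: le_trans cover_le _; apply: le_trans sum_le _.
apply: le_trans (lerD good_le (lexx _)) _.
rewrite -addrA lerD2l -mulrDr mulrA ler_wpM2r// addr_ge0// mulr_ge0//.
Qed.

Lemma log_partition_folner K (e : R) : K != fset0 -> 0 < e ->
  \forall F \near folner R G, F != fset0 /\
    log_partition phi F <= #|` F|%:R * (#|` K|%:R^-1 * log_partition phi K + e).
Proof.
move=> K0 e0.
(* The bound per point is made non-negative so that it can be multiplied by an upper bound on the
   cardinality of a cut translate. *)
set c := Num.max 0 (ln (head_sum phi)).
set M := `|log_partition phi K| + #|` K|%:R * c.
have c0 : 0 <= c by rewrite le_max lexx.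
have M0 : 0 <= M by rewrite addr_ge0// mulr_ge0.
have d0 : 0 < e / (M + 1) by rewrite divr_gt0// ltr_wpDl.
have := folner_boundary (fset_mul K (fset_inv K)) d0.
apply: filterS => F [F0 FK]; split=> //.
apply: le_trans (log_partition_cover_translates F K0 c0 _) _.
  by rewrite le_max lexx orbT.
rewrite [leRHS]mulrDr lerD2l -/M.
apply: le_trans (ler_wpM2r M0 FK) _.
rewrite mulrAC [leRHS]mulrC ler_wpM2r// mulrAC ler_pdivrMr ?ltr_wpDl//.
by rewrite ler_wpM2l ?ltW// ltrDl.
Qed.

Lemma birkhoff_cst F (a : nat) :
  birkhoff phi F (fun=> a) = #|` F|%:R * phi (fun=> a).
Proof.
rewrite /birkhoff (eq_bigr (fun=> phi (fun=> a)))//.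
by rewrite big_const_seq count_predT iter_addr_0 mulr_natl.
Qed.

(** All normalized values are at least their infimum. A [K] within [e / 2] of it forces them to be
    eventually within [e]; amenability makes the filter proper, so that the limit is unique. *)
Lemma log_partition_cvg : amenable R G ->
  #|` F|%:R^-1 * log_partition phi F @[F --> folner R G] --> pressure phi.
Proof.
move=> am; have pf := folner_proper am.
set f := fun F : {fset G} => #|` F|%:R^-1 * log_partition phi F.
pose S := [set f K | K in [set K | K != fset0]].
suff fS : f @ folner R G --> inf S.
  by rewrite (_ : pressure phi = inf S)//; exact: cvg_lim fS.
have card_gt0 F : F != fset0 -> 0 < #|` F|%:R :> R.
  by rewrite ltr0n cardfs_gt0.
have S0 : has_inf S.
  split; first by exists (f [fset 1%g]%fset), [fset 1%g]%fset => //=;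
    rewrite -cardfs_gt0 cardfs1.
  (* A constant configuration is fixed by all shifts, so its normalized Birkhoff sums all equal its
     potential and bound the values from below. *)
  exists (phi (fun=> 0%N)) => _ [F /= F0 <-].
  by rewrite /f ler_pdivlMl ?card_gt0// -birkhoff_cst birkhoff_le_log_partition.
apply/cvgrPdist_le => e e0.
have e20 : 0 < e / 2 by rewrite divr_gt0.
have [_ [K /= K0 <-] fK] := inf_adherent e20 S0.
have := log_partition_folner K0 e20; apply: filterS => F [F0 FK].
have infF : inf S <= f F by apply: (ge_inf S0.2); exists F.
rewrite distrC ger0_norm ?subr_ge0// lerBlDr /f ler_pdivrMl ?card_gt0//.
apply: le_trans FK _; rewrite ler_wpM2l//; rewrite /f in fK *; lra.
Qed.

End pressure_limit.

(** * Oscillation of Birkhoff sums *)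

Section variation.
Variables (R : realType) (G : groupType) (E : nat -> {fset G}).
Variable phi : config G -> R.
Hypothesis Eexh : exhausting E.
Hypothesis phi_var : summable_variation phi E.
Implicit Types (F A : {fset G}) (g : G) (x y : config G).

Definition layer_card (m : nat) : R :=
  #|` (fset_inv (E m.+1) `\` fset_inv (E m))%fset|%:R.

Definition variation_at (m : nat) : R := fine (cvariation phi (E m)).

Lemma exhausting1 m : (0 < m)%N -> 1%g \in E m.
Proof.
case: Eexh => _ E1 Elt _; elim: m => [//|[|m] IH _]; first by rewrite E1 inE.
by apply: (fsubsetP (fproper_sub (Elt m.+1))); exact: IH.
Qed.

Lemma exhausting_le m n : (m <= n)%N -> (E m `<=` E n)%fset.
Proof.
case: Eexh => _ _ Elt _; elim: n => [|n IH]; first by rewrite leqn0 => /eqP ->.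
rewrite leq_eqVlt => /predU1P[->//|]; rewrite ltnS => /IH mn.
exact: fsubset_trans mn (fproper_sub (Elt n)).
Qed.

Lemma layer_card_ge1 m : 1 <= layer_card m.
Proof.
case: Eexh => _ _ /(_ m) + _; rewrite fproperE => /andP[_ /fsubsetPn[g gE gNE]].
rewrite /layer_card ler1n cardfs_gt0; apply/fset0Pn; exists (g^-1)%g.
rewrite inE (mem_fset_inv gE) andbT; apply: contra gNE.
by move=> /imfsetP[h hE /invg_inj ->].
Qed.

Lemma cvariation_ge0 F : (0 <= cvariation phi F)%E.
Proof.
apply: ereal_sup_ubound; exists (fun=> 0%N), (fun=> 0%N); split=> //.
by rewrite subrr normr0.
Qed.

Lemma variation_term_ge0 m :
  (0 <= (layer_card m)%:E * cvariation phi (E m))%E.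
Proof. by rewrite mule_ge0 ?cvariation_ge0// lee_fin ler0n. Qed.

Lemma partial_variation_lty N :
  (\sum_(1 <= m < N) (layer_card m)%:E * cvariation phi (E m) < +oo)%E.
Proof.
move: phi_var; rewrite /summable_variation; apply: le_lt_trans.
by apply: nneseries_lim_ge => m _ _; exact: variation_term_ge0.
Qed.

(** Layers are nonempty, so each variation is at most its weighted term in a convergent series. The
    series starts at 1: [E 0] is empty and its variation may be infinite. *)
Lemma variationE m : (0 < m)%N -> cvariation phi (E m) = (variation_at m)%:E.
Proof.
move=> m0; rewrite /variation_at fineK// ge0_fin_numE ?cvariation_ge0//.
apply: le_lt_trans (partial_variation_lty m.+1); rewrite big_nat_recr//=.
apply: (@le_trans _ _ ((layer_card m)%:E * cvariation phi (E m))%E).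
  by rewrite lee_pemull ?cvariation_ge0// lee_fin layer_card_ge1.
by rewrite leeDr// sume_ge0// => k _; exact: variation_term_ge0.
Qed.

Lemma variation_at_ge0 m : 0 <= variation_at m.
Proof. exact/fine_ge0/cvariation_ge0. Qed.

Lemma le_variation_at m x y : (0 < m)%N -> crestrict (E m) x = crestrict (E m) y ->
  `|phi x - phi y| <= variation_at m.
Proof.
move=> m0 xy; rewrite -lee_fin -variationE//; apply: ereal_sup_ubound.
by exists x, y.
Qed.

Lemma variation_at_le1 m : (0 < m)%N -> variation_at m <= variation_at 1.
Proof.
move=> m0; rewrite -lee_fin -!variationE//; apply: ereal_sup_le.
move=> _ [x [y [/crestrictP xy ->]]]; exists x, y; split=> //.
by apply/crestrictP => g /(fsubsetP (exhausting_le m0)) /xy.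
Qed.

Lemma variation_tail (e : R) : 0 < e -> exists2 J, (0 < J)%N &
  forall N, \sum_(J <= m < N) layer_card m * variation_at m <= e.
Proof.
move=> e0; pose s N := \sum_(1 <= m < N) layer_card m * variation_at m.
have term_ge0 m : 0 <= layer_card m * variation_at m.
  by rewrite mulr_ge0 ?variation_at_ge0.
have s_sup : has_sup (range s).
  split; first by exists (s 0%N), 0%N.
  exists (fine (\sum_(1 <= m <oo) (layer_card m)%:E * cvariation phi (E m))%E).
  move=> _ [N _ <-].
  rewrite -lee_fin fineK; last first.
    rewrite ge0_fin_numE//; apply: nneseries_ge0 => m _ _.
    exact: variation_term_ge0.
  apply: le_trans (nneseries_lim_ge N _); last first.
    by move=> m _ _; exact: variation_term_ge0.
  rewrite /s -sumEFin le_eqVlt; apply/orP; left; apply/eqP.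
  by apply: eq_big_nat => m /andP[m0 _]; rewrite variationE.
have [_ [N0 _ <-] sN0] := sup_adherent e0 s_sup.
(* From a partial sum within [e] of the supremum on, the remaining sums are at most [e]; the maximum
   with 1 keeps the index positive. *)
exists (maxn N0 1); first by rewrite leq_max orbT.
move=> N; have [NJ|JN] := leqP N (maxn N0 1).
  by rewrite big_geq// ltW.
have J0 : (0 < maxn N0 1)%N by rewrite leq_max orbT.
have sJ : s N0 <= s (maxn N0 1).
  case: N0 {sN0 JN} J0 => [|n] _; first by rewrite /s big_geq// sumr_ge0.
  by rewrite (maxn_idPl _).
have sN : s N <= sup (range s) by apply: (ub_le_sup s_sup.2); exists N.
have : s N =
    s (maxn N0 1) + \sum_(maxn N0 1 <= m < N) layer_card m * variation_at m.
  by rewrite /s -big_cat_nat// ltnW.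
lra.
Qed.

Definition hits F g (n : nat) : bool := has (fun e => (e * g)%g \in F) (E n).

(* For [g] outside of [F], the largest [m] such that the configurations
   [cshift g x] and [cshift g y] agree on [E m] whenever [x] and [y] agree
   outside of [F]. *)
Definition level F g : nat :=
  if pselect (exists n, hits F g n) is left ex then (ex_minn ex).-1 else 0%N.

(** There is no hit at index 0, where [E 0] is empty, nor at 1, where [E 1] only contains the
    identity. The first hit is thus at 2 or later, and it exists because [f / g] lies in some
    [E n]. *)
Lemma levelP F g : F != fset0 -> g \notin F ->
  [/\ (0 < level F g)%N, ~~ hits F g (level F g) & hits F g (level F g).+1].
Proof.
move=> /fset0Pn[f fF] gF; rewrite /level; case: pselect => [ex|[]]; last first.
  case: Eexh => _ _ _ /(_ (f / g)%g)[n nE]; exists n.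
  by apply/hasP; exists (f / g)%g; rewrite // mulgVK.
case: ex_minnP => -[|[|n]] hit hmin /=.
- by move: hit; case: Eexh => E0 _ _ _; rewrite /hits E0.
- move: hit => /hasP[e]; case: Eexh => _ -> _ _; rewrite inE => /eqP ->.
  by rewrite mul1g (negbTE gF).
- split=> //; apply/negP => /hmin; by rewrite ltnn.
Qed.

Lemma birkhoff_outside F A x y : F != fset0 -> [disjoint A & F]%fset ->
  (forall g, g \notin F -> x g = y g) ->
  `|birkhoff phi A x - birkhoff phi A y| <= \sum_(g <- A) variation_at (level F g).
Proof.
move=> F0 AF xy; rewrite /birkhoff -sumrB.
apply: le_trans (ler_norm_sum _ _ _) _.
rewrite big_seq [leRHS]big_seq; apply: ler_sum => g gA.
have [lev0 /hasPn nhit _] := levelP F0 (fdisjointP AF g gA).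
apply: le_variation_at => //; apply/crestrictP => e eE.
exact/xy/nhit.
Qed.

(** Points of level below [J] lie in the boundary of [F] and cost at most [variation_at 1] each.
    Those of level [m >= J] number at most [layer_card m * #|F|], which leaves the tail of the
    series. *)
Lemma sum_level_le F A (J : nat) (t : R) : F != fset0 -> [disjoint A & F]%fset ->
  (0 < J)%N -> (forall N, \sum_(J <= m < N) layer_card m * variation_at m <= t) ->
  \sum_(g <- A) variation_at (level F g) <=
  #|` fset_mul (fset_inv (E J)) F `\` F|%fset%:R * variation_at 1
    + #|` F|%:R * t.
Proof.
move=> F0 AF J0 tail.
have lev g : g \in A -> _ := fun gA => levelP F0 (fdisjointP AF g gA).
rewrite (bigID (fun g => level F g < J)%N)/=; apply: lerD.
  apply: (@le_trans _ _ (\sum_(g <- A | (level F g < J)%N) variation_at 1)).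
    rewrite big_seq_cond [leRHS]big_seq_cond; apply: ler_sum => g /andP[gA _].
    by apply: variation_at_le1; have [] := lev g gA.
  rewrite big_const_seq iter_addr_0 -[_ *+ count _ _]mulr_natl.
  rewrite ler_wpM2r ?variation_at_ge0//.
  rewrite ler_nat -size_filter; apply: uniq_leq_size.
    by rewrite filter_uniq ?fset_uniq.
  move=> g; rewrite mem_filter => /andP[levJ gA].
  rewrite inE (fdisjointP AF g gA)/=; have [_ _ /hasP[e eE egF]] := lev g gA.
  rewrite -(mulKg e g); apply: mem_fset_mul => //; apply: mem_fset_inv.
  exact: (fsubsetP (exhausting_le levJ)).
pose N := (\max_(g <- A) level F g).+1.
have lev_lt g : g \in A -> (level F g < N)%N.
  by move=> gA; rewrite ltnS /N (big_rem g)//= leq_maxl.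
(* Inserting a sum over the value [m] of the level allows the exchange of sums that groups the
   points by level. *)
have -> : \sum_(g <- A | ~~ (level F g < J)%N) variation_at (level F g) =
    \sum_(g <- A | ~~ (level F g < J)%N)
      \sum_(J <= m < N | m == level F g) variation_at m.
  rewrite big_seq_cond [RHS]big_seq_cond; apply: eq_bigr => g /andP[gA].
  by rewrite -leqNgt big_nat1_eq lev_lt// => ->.
rewrite (exchange_big_dep xpredT)//=.
apply: (@le_trans _ _
    (\sum_(J <= m < N) #|` F|%:R * (layer_card m * variation_at m))); last first.
  by rewrite -mulr_sumr ler_wpM2l.
apply: ler_sum => m _; rewrite big_const_seq iter_addr_0 -[_ *+ count _ _]mulr_natl mulrA.
rewrite ler_wpM2r ?variation_at_ge0// mulrC -natrM ler_nat.
apply: leq_trans (card_fset_mul_le _ _); rewrite -size_filter.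
apply: uniq_leq_size; first by rewrite filter_uniq ?fset_uniq.
move=> g; rewrite mem_filter => /andP[/andP[_ /eqP mE] gA].
have [_ nhit /hasP[e eE egF]] := lev g gA; rewrite -mE in nhit eE.
rewrite -(mulKg e g); apply: mem_fset_mul => //.
rewrite inE (mem_fset_inv eE) andbT; apply: contra nhit.
by move=> /imfsetP[e' e'E /invg_inj eE']; apply/hasP; exists e; rewrite // eE'.
Qed.

(** Where [E J * g] stays in [F], the shifted configurations agree on [E J]. At the boundary points
    of [F] they still agree at the identity, which gives [variation_at 1]. *)
Lemma birkhoff_inside F x y (J : nat) : (0 < J)%N ->
  crestrict F x = crestrict F y ->
  `|birkhoff phi F x - birkhoff phi F y| <= #|` F|%:R * variation_at J +
    #|` E J|%:R
      * #|` fset_mul (fset_mul (E J) (fset_inv (E J))) F `\` F|%fset%:R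
      * variation_at 1.
Proof.
move=> J0 /crestrictP xy.
rewrite /birkhoff -sumrB; apply: le_trans (ler_norm_sum _ _ _) _.
pose inner g := all (fun e => (e * g)%g \in F) (E J).
rewrite (bigID inner)/=; apply: lerD.
  apply: (@le_trans _ _ (\sum_(g <- F | inner g) variation_at J)).
    apply: ler_sum => g /allP ing; apply: le_variation_at => //.
    by apply/crestrictP => e /ing/xy.
  rewrite big_const_seq iter_addr_0 -[_ *+ count _ _]mulr_natl.
  rewrite ler_wpM2r ?variation_at_ge0//.
  by rewrite ler_nat count_size.
apply: (@le_trans _ _ (\sum_(g <- F | ~~ inner g) variation_at 1)).
  rewrite big_seq_cond [leRHS]big_seq_cond; apply: ler_sum => g /andP[gF _].
  apply: le_variation_at => //; apply/crestrictP => e.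
  by case: Eexh => _ -> _ _; rewrite inE => /eqP ->; apply: xy; rewrite mul1g.
rewrite big_const_seq iter_addr_0 -[_ *+ count _ _]mulr_natl.
rewrite ler_wpM2r ?variation_at_ge0//.
rewrite -natrM ler_nat; apply: card_boundary_le; first exact: fset_uniq.
move=> g gF; rewrite -[g]mul1g; apply: mem_fset_mul => //.
by rewrite -invg1; apply: mem_fset_inv; exact: exhausting1.
Qed.

Lemma variation_le_tail (J : nat) (t : R) :
  (forall N, \sum_(J <= m < N) layer_card m * variation_at m <= t) ->
  variation_at J <= t.
Proof.
move=> /(_ J.+1); rewrite big_nat1; apply: le_trans.
by rewrite ler_peMl ?variation_at_ge0 ?layer_card_ge1.
Qed.

Lemma oscillation_folner (e : R) : 0 < e -> \forall F \near folner R G,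
  (forall x y, crestrict F x = crestrict F y ->
    `|birkhoff phi F x - birkhoff phi F y| <= e * #|` F|%:R) /\
  (forall A, [disjoint A & F]%fset ->
    \sum_(g <- A) variation_at (level F g) <= e * #|` F|%:R).
Proof.
move=> e0; have e20 : 0 < e / 2 by rewrite divr_gt0.
have [J J0 tail] := variation_tail e20.
set v := variation_at 1; have v0 : 0 <= v by exact: variation_at_ge0.
pose c : R := #|` E J|%:R + 1.
have c1 : 1 <= c by rewrite lerDr.
have c0 : 0 < c by exact: lt_le_trans c1.
(* The invariance constant makes either boundary term at most [e / 2]; the other half pays for the
   tail beyond [J]. Adding 1 to both factors keeps the denominator positive. *)
have d0 : 0 < e / 2 / (c * (v + 1)) by rewrite divr_gt0// mulr_gt0// ltr_wpDl.
have dE : e / 2 / (c * (v + 1)) * (c * (v + 1)) = e / 2.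
  by rewrite mulfVK// gt_eqF// mulr_gt0// ltr_wpDl.
have h1 := folner_boundary (fset_inv (E J)) d0.
have h2 := folner_boundary (fset_mul (E J) (fset_inv (E J))) d0.
apply: filterS2 h1 h2 => F [F0 b1] [_ b2].
move: (e / 2 / _) d0 dE b1 b2 => d d0 dE b1 b2.
have n0 : 0 <= #|` F|%:R :> R by [].
split=> [x y xy|A AF].
  apply: le_trans (birkhoff_inside J0 xy) _; rewrite -/v.
  have vJ := variation_le_tail tail.
  apply: (@le_trans _ _ (#|` F|%:R * (e / 2) + c * (d * #|` F|%:R) * (v + 1))).
    apply: lerD; first by rewrite ler_wpM2l.
    apply: ler_pM; [by rewrite mulr_ge0|by []| |by rewrite lerDl].
    by apply: ler_pM => //; rewrite lerDl.
  have -> : c * (d * #|` F|%:R) * (v + 1) = #|` F|%:R * (d * (c * (v + 1))) by ring.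
  by rewrite dE; lra.
apply: le_trans (sum_level_le F0 AF J0 tail) _; rewrite -/v.
apply: (@le_trans _ _ (d * #|` F|%:R * (c * (v + 1)) + #|` F|%:R * (e / 2))).
  rewrite lerD2r; apply: ler_pM => //.
  rewrite -[leLHS]mul1r; apply: ler_pM => //; by rewrite lerDl.
have -> : d * #|` F|%:R * (c * (v + 1)) = #|` F|%:R * (d * (c * (v + 1))) by ring.
by rewrite dE; lra.
Qed.

End variation.

Lemma fdisjointDX (T : choiceType) (A B : {fset T}) : [disjoint B `\` A & A]%fset.
Proof. by apply/fdisjointP => g; rewrite inE => /andP[]. Qed.

Lemma sum_fsetD (R : realType) (T : choiceType) (f : T -> R) (A B : {fset T}) :
  (A `<=` B)%fset ->
  \sum_(g <- B) f g = \sum_(g <- A) f g + \sum_(g <- (B `\` A)%fset) f g.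
Proof.
move=> /fsubsetP AB; rewrite -big_cat/=; apply: perm_big; apply: uniq_perm.
- exact: fset_uniq.
- rewrite cat_uniq !fset_uniq andbT/=; apply/hasPn => g.
  by rewrite inE => /andP[].
- move=> g; rewrite mem_cat inE.
  by have [/AB ->|] := boolP (g \in A).
Qed.

(** * The Gibbs kernel *)

Section esum_expR.
Variables (R : realType) (T : choiceType).

Lemma esum_expR_le (a b : T -> R) (c : R) : (forall v, a v <= b v + c) ->
  (\esum_(v in [set: T]) (expR (a v))%:E
   <= (expR c)%:E * \esum_(v in [set: T]) (expR (b v))%:E)%E.
Proof.
move=> abc; apply: ge_ereal_sup => _ [X [finX _] <-].
apply: (@le_trans _ _ ((expR c)%:E * \sum_(v \in X) (expR (b v))%:E)%E).
  rewrite ge0_mule_fsumr; last by move=> v; rewrite lee_fin expR_ge0.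
  apply: lee_fsum => // v _.
  by rewrite -EFinM lee_fin -expRD ler_expR addrC.
rewrite lee_pmul2l ?lte_fin ?expR_gt0//.
by apply: esum_ge; exists X.
Qed.

Lemma esum_expR_le_expR (a b : T -> R) (c l : R) :
  \esum_(v in [set: T]) (expR (b v))%:E = (expR l)%:E ->
  (forall v, a v <= b v + c) ->
  (\esum_(v in [set: T]) (expR (a v))%:E <= (expR (c + l))%:E)%E.
Proof.
by move=> bl /esum_expR_le /le_trans; apply; rewrite bl -EFinM -expRD.
Qed.

Lemma esum_expR_gt0 (a : T -> R) (v : T) :
  (0 < \esum_(v in [set: T]) (expR (a v))%:E)%E.
Proof.
apply: (@lt_le_trans _ _ (expR (a v))%:E); first by rewrite lte_fin expR_gt0.
apply: esum_ge; exists [set v]; last by rewrite fsbig_set1.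
by split=> //; exact: finite_set1.
Qed.

End esum_expR.

Section gibbs_weight_theory.
Variables (R : realType) (G : groupType) (phi : config G -> R).
Variables (F : {fset G}) (x : config G).
Implicit Types (A : {fset G}) (w : {ffun F -> nat}).

Lemma gibbs_weightT A : gibbs_weight phi A F setT x =
  \esum_(v in [set: {ffun F -> nat}]) (expR (birkhoff phi A (csplice v x)))%:E.
Proof. by apply: eq_esum => v _; rewrite indicT mulr1. Qed.

Lemma gibbs_weight_cylinder A w : gibbs_weight phi A F (ccylinder w) x =
  (expR (birkhoff phi A (csplice w x)))%:E.
Proof.
rewrite -(esum_set1 (t := w)
  (a := fun v => (expR (birkhoff phi A (csplice v x)))%:E)); last first.
  by rewrite lee_fin expR_ge0.
rewrite [RHS]esum_mkcond; apply: eq_esum => v _.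
rewrite indicE /ccylinder; have [->|vw] := eqVneq v w.
  by rewrite !mem_set ?mulr1//=; exact: crestrict_csplice.
rewrite !memNset ?mulr0//=; first exact/eqP.
by rewrite crestrict_csplice; exact/eqP.
Qed.

Lemma birkhoffD A B z : (A `<=` B)%fset ->
  birkhoff phi B z = birkhoff phi A z + birkhoff phi (B `\` A)%fset z.
Proof. by move=> AB; rewrite /birkhoff (sum_fsetD _ AB). Qed.

End gibbs_weight_theory.

Section gibbs_kernel_theory.
Variables (R : realType) (G : groupType) (E : nat -> {fset G}).
Variable phi : config G -> R.
Hypotheses (Eexh : exhausting E) (phi_exp : exp_summable phi).
Hypothesis phi_var : summable_variation phi E.
Variables (F : {fset G}) (x : config G).
Hypothesis F0 : F != fset0.
Implicit Types (A B : {fset G}) (v w : {ffun F -> nat}).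

Local Notation lev_sum A := (\sum_(g <- A) variation_at E phi (level E F g)).

Definition log_weight A : R := ln (fine (gibbs_weight phi A F setT x)).

Definition log_ratio A w : R :=
  birkhoff phi A (csplice w x) - log_weight A.

Lemma birkhoff_splice A v w : [disjoint A & F]%fset ->
  `|birkhoff phi A (csplice v x) - birkhoff phi A (csplice w x)| <= lev_sum A.
Proof.
by move=> AF; apply: birkhoff_outside => // g gF; rewrite !csplice_out.
Qed.

(** Replacing [v] by [w] changes the part outside [F] by at most the level sum. The part over [F] is
    bounded by [cell_sup], whose exponentials sum to the partition function. *)
Lemma gibbs_weight_le A w : (F `<=` A)%fset ->
  (gibbs_weight phi A F setT x <= (expR (birkhoff phi (A `\` F)%fset (csplice w x)
     + lev_sum (A `\` F)%fset + log_partition phi F))%:E)%E.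
Proof.
move=> FA; rewrite gibbs_weightT.
apply: (esum_expR_le_expR (b := fun v => cell_sup phi F (csplice v x))).
  by rewrite -(partition_functionE phi_exp) partition_functionK.
move=> v.
have := birkhoff_splice v w (fdisjointDX F A).
rewrite (birkhoffD phi _ FA) ler_distl => /andP[_ h].
have := birkhoff_le_cell_sup phi_exp (erefl (crestrict F (csplice v x))).
by move: h; lra.
Qed.

Lemma gibbs_weightK A : (F `<=` A)%fset ->
  gibbs_weight phi A F setT x = (expR (log_weight A))%:E.
Proof.
move=> FA; have w : {ffun F -> nat} := [ffun=> 0%N].
have W0 : (0 < gibbs_weight phi A F setT x)%E.
  by rewrite gibbs_weightT; exact: esum_expR_gt0 w.
have Wfin : gibbs_weight phi A F setT x \is a fin_num.
  rewrite ge0_fin_numE ?ltW//.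
  exact: le_lt_trans (gibbs_weight_le w FA) (ltry _).
by rewrite /log_weight lnK ?fineK// posrE -lte_fin fineK.
Qed.

Lemma gibbs_ratioE A w : (F `<=` A)%fset ->
  fine (gibbs_weight phi A F (ccylinder w) x) /
  fine (gibbs_weight phi A F setT x) = expR (log_ratio A w).
Proof.
move=> FA; rewrite gibbs_weight_cylinder gibbs_weightK//=.
by rewrite -expRN -expRD.
Qed.

Lemma log_ratio_ge A w y t o : (F `<=` A)%fset -> crestrict F y = w ->
  (forall y z, crestrict F y = crestrict F z ->
    `|birkhoff phi F y - birkhoff phi F z| <= o) ->
  lev_sum (A `\` F)%fset <= t ->
  birkhoff phi F y - log_partition phi F - (t + 2 * o) <= log_ratio A w.
Proof.
move=> FA yw osc levt; rewrite /log_ratio (birkhoffD phi _ FA).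
have : log_weight A <= birkhoff phi (A `\` F)%fset (csplice w x)
     + lev_sum (A `\` F)%fset + log_partition phi F.
  by rewrite -ler_expR -lee_fin -(gibbs_weightK FA); exact: gibbs_weight_le.
have : crestrict F (csplice w x) = crestrict F y by rewrite crestrict_csplice.
(* This direction loses a single [o]; the second one matches the upper bound and only weakens the
   estimate, since [o >= 0]. *)
move=> /osc o1; have o0 : 0 <= o by apply: le_trans o1; exact: normr_ge0.
by move: o1; rewrite ler_distl => /andP[+ _]; lra.
Qed.

Lemma log_ratio_le A w y t o : (F `<=` A)%fset -> crestrict F y = w ->
  (forall y z, crestrict F y = crestrict F z ->
    `|birkhoff phi F y - birkhoff phi F z| <= o) ->
  lev_sum (A `\` F)%fset <= t ->
  log_ratio A w <= birkhoff phi F y - log_partition phi F + (t + 2 * o).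
Proof.
move=> FA yw osc levt; rewrite /log_ratio (birkhoffD phi _ FA).
have : birkhoff phi (A `\` F)%fset (csplice w x) - lev_sum (A `\` F)%fset - o
     + log_partition phi F <= log_weight A.
  rewrite addrC -lerBrDr [leRHS]addrC -ler_expR -lee_fin.
  rewrite -(partition_functionK phi_exp F) (partition_functionE phi_exp F x).
  apply: (esum_expR_le_expR (b := fun v => birkhoff phi A (csplice v x))).
    by rewrite -gibbs_weightT gibbs_weightK.
  (* Bounding the weight from below compares each cell supremum with the value at [csplice v x], at
     the cost of one [o]; moving from [csplice w x] to [y] costs the other. *)
  move=> v; apply: cell_sup_le => z zv.
  have := osc _ _ zv; rewrite ler_distl => /andP[_ h1].
  have := birkhoff_splice v w (fdisjointDX F A).
  rewrite (birkhoffD phi _ FA) ler_distl => /andP[h2 _].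
  by move: h1 h2; lra.
have : crestrict F (csplice w x) = crestrict F y by rewrite crestrict_csplice.
by move=> /osc; rewrite ler_distl => /andP[_]; lra.
Qed.

(** Enlarging [A] to [B] multiplies all the weights by nearly the same factor, because the added
    Birkhoff sum varies with the word by at most its level sum. That factor cancels in the ratio. *)
Lemma log_ratio_step A B w : (F `<=` A)%fset -> (A `<=` B)%fset ->
  `|log_ratio B w - log_ratio A w| <= lev_sum (B `\` A)%fset.
Proof.
move=> FA AB; have FB := fsubset_trans FA AB.
have dis : [disjoint B `\` A & F]%fset.
  exact: fdisjointWr FA (fdisjointDX A B).
set b := birkhoff phi (B `\` A)%fset (csplice w x); set s := lev_sum _.
have up : log_weight B <= b + s + log_weight A.
  rewrite -ler_expR -lee_fin -(gibbs_weightK FB) gibbs_weightT.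
  apply: (esum_expR_le_expR (b := fun v => birkhoff phi A (csplice v x))).
    by rewrite -gibbs_weightT gibbs_weightK.
  move=> v; have := birkhoff_splice v w dis.
  by rewrite (birkhoffD phi _ AB) ler_distl => /andP[_]; rewrite -/b -/s; lra.
have down : log_weight A <= (s - b) + log_weight B.
  rewrite -ler_expR -lee_fin -(gibbs_weightK FA) gibbs_weightT.
  apply: (esum_expR_le_expR (b := fun v => birkhoff phi B (csplice v x))).
    by rewrite -gibbs_weightT gibbs_weightK.
  move=> v; have := birkhoff_splice v w dis.
  by rewrite (birkhoffD phi _ AB) ler_distl => /andP[+ _]; rewrite -/b -/s; lra.
rewrite /log_ratio (birkhoffD phi _ AB) -/b ler_norml.
move: (birkhoff phi A _) (log_weight A) (log_weight B) b s up down.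
by move=> a lA lB b s up down; apply/andP; split; lra.
Qed.

Lemma exhausting_cover : exists m, (F `<=` E m)%fset.
Proof.
case: (Eexh) => _ _ _ Ecov; have [f fE] := choice Ecov.
exists (\max_(g <- F) f g); apply/fsubsetP => g gF.
apply: (fsubsetP (exhausting_le Eexh _) _ (fE g)).
by rewrite (big_rem g)//= leq_maxl.
Qed.

Lemma gibbs_ratio_cvg w : cvgn (fun m =>
  fine (gibbs_weight phi (E m) F (ccylinder w) x) /
  fine (gibbs_weight phi (E m) F setT x)).
Proof.
have [m0 FE] := exhausting_cover.
have FEn n : (F `<=` E (n + m0)%N)%fset.
  exact: fsubset_trans FE (exhausting_le Eexh (leq_addl _ _)).
pose q n := log_ratio (E (n + m0)%N) w.
pose s n := lev_sum (E (n + m0)%N `\` F)%fset.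
have lev_ge0 A : 0 <= lev_sum A.
  by apply: sumr_ge0 => g _; exact: variation_at_ge0.
have sS n : s n.+1 = s n + lev_sum (E (n.+1 + m0) `\` E (n + m0))%fset.
  have EE : (E (n + m0) `<=` E (n.+1 + m0))%fset.
    by apply: exhausting_le => //; rewrite addSn leqnSn.
  rewrite /s (sum_fsetD _ (fsetSD F EE)).
  suff -> : ((E (n.+1 + m0) `\` F) `\` (E (n + m0) `\` F)
      = E (n.+1 + m0) `\` E (n + m0))%fset by [].
  apply/fsetP => g; rewrite !inE.
  have [/(fsubsetP (FEn n)) ->|] := boolP (g \in F); first by rewrite andbF.
  by move=> _.
have [J J0 tail] := variation_tail Eexh phi_var ltr01.
have [t st] : exists t : R, forall n, s n <= t.
  have h n := sum_level_le Eexh phi_var F0 (fdisjointDX F (E (n + m0)%N)) J0 tail.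
  by eexists; exact: h.
have s_cvg : cvgn s.
  apply: nondecreasing_is_cvgn; last by exists t => _ [n _ <-].
  by apply/nondecreasing_seqP => n; rewrite sS lerDl.
have [c osc] : exists c : R, forall y z, crestrict F y = crestrict F z ->
    `|birkhoff phi F y - birkhoff phi F z| <= c.
  have h y z := @birkhoff_inside _ _ _ _ Eexh phi_var F y z J J0.
  by eexists; exact: h.
(* The increments of [s] dominate those of [q] in absolute value, so [q + s] is monotone and
   bounded; subtracting the convergent [s] gives the convergence of [q]. *)
have qs_cvg : cvgn (q \+ s).
  apply: nondecreasing_is_cvgn.
    apply/nondecreasing_seqP => n /=.
    have /(log_ratio_step w (FEn n)) : (E (n + m0) `<=` E (n.+1 + m0))%fset.
      by apply: exhausting_le => //; rewrite addSn leqnSn.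
    rewrite sS -/(q n) -/(q n.+1) ler_norml => /andP[+ _].
    by move: (q n) (q n.+1) (s n) (lev_sum _) => *; lra.
  exists (birkhoff phi F (csplice w x) - log_partition phi F + (t + 2 * c) + t).
  move=> _ [n _ <-]; apply: lerD; last exact: st.
  by apply: log_ratio_le => //; rewrite ?crestrict_csplice//; exact: st.
have q_cvg : cvgn q.
  rewrite (_ : q = (q \+ s) \- s); first exact: is_cvgB.
  by apply/funext => n /=; rewrite addrK.
apply/cvg_ex; exists (expR (limn q)); rewrite -(cvg_shiftn m0).
rewrite (_ : (fun n => _) = expR \o q).
  exact: continuous_cvg (@continuous_expR R _) q_cvg.
by apply/funext => n; rewrite /= gibbs_ratioE.
Qed.

Lemma gibbs_kernel_bounds w y t o : crestrict F y = w ->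
  (forall y z, crestrict F y = crestrict F z ->
    `|birkhoff phi F y - birkhoff phi F z| <= o) ->
  (forall A, [disjoint A & F]%fset -> lev_sum A <= t) ->
  expR (birkhoff phi F y - log_partition phi F - (t + 2 * o))
  <= gibbs_kernel phi E F (ccylinder w) x
  <= expR (birkhoff phi F y - log_partition phi F + (t + 2 * o)).
Proof.
move=> yw osc levt; have [m0 FE] := exhausting_cover.
have near_E : \forall m \near \oo, (F `<=` E m)%fset.
  exists m0 => // m /= m0m; exact: fsubset_trans FE (exhausting_le Eexh m0m).
apply/andP; split.
  apply: limr_ge; first exact: gibbs_ratio_cvg.
  apply: filterS near_E => m FEm; rewrite gibbs_ratioE// ler_expR.
  by apply: log_ratio_ge => //; apply: levt; exact: fdisjointDX.
apply: limr_le; first exact: gibbs_ratio_cvg.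
apply: filterS near_E => m FEm; rewrite gibbs_ratioE// ler_expR.
by apply: log_ratio_le => //; apply: levt; exact: fdisjointDX.
Qed.

End gibbs_kernel_theory.

(** * Conditional probabilities *)

Section coordinate_algebra.
Variables (R : realType) (G : groupType).
Implicit Types (D : set G) (F : {fset G}).

Lemma measurable_coord g (Y : set nat) :
  measurable (@ccoord G g @^-1` Y : set (config G)).
Proof.
apply: sub_sigma_algebra.
apply: (continuousP _).1 (discrete_open Y).
exact: (@proj_continuous G (fun=> nat) g).
Qed.

Lemma coord_algebra_measurable D (A : set (config G)) :
  <<s coord_events D >> A -> measurable A.
Proof.
apply: smallest_sub A; first exact: sigma_algebra_measurable.
move=> _ [g Dg [Y _ <-]]; rewrite setTI; exact: measurable_coord.
Qed.

Lemma measurable_ccylinder F (w : {ffun F -> nat}) :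
  measurable (ccylinder w : set (config G)).
Proof.
rewrite (_ : ccylinder w = \bigcap_(g in [set` F])
    (@ccoord G g @^-1` [set csplice w (fun=> 0%N) g])); last first.
  apply/seteqP; split => x /=.
    by rewrite /ccylinder/= -{1}(crestrict_csplice w (fun=> 0%N)) => /crestrictP.
  move=> xw; rewrite /ccylinder/= -(crestrict_csplice w (fun=> 0%N)).
  exact/crestrictP.
by apply: fin_bigcap_measurable => // g _; exact: measurable_coord.
Qed.

(** The event [f' < f] belongs to the coordinate sigma-algebra, so both versions have the same
    integral over it; the positive difference then vanishes almost everywhere there. *)
Lemma cond_prob_ae_le (mu : probability (config G) R) D B (f f' : config G -> R) :
  cond_prob mu D B f -> cond_prob mu D B f' -> {ae mu, forall x, f x <= f' x}.
Proof.
move=> [mf intf fB] [mf' intf' f'B].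
pose A := [set x | f' x < f x].
have DA : <<s coord_events D >> A.
  have := @measurable_fun_ltr _ (g_sigma_algebraType (coord_events D)) R setT f' f
    mf' mf.
  move=> /(_ measurableT [set true] I); rewrite setTI.
  by congr (<<s _ >> _); apply/seteqP; split => x.
have mA := coord_algebra_measurable DA.
have intfA := integrableS measurableT mA (@subsetT _ A) intf.
have intf'A := integrableS measurableT mA (@subsetT _ A) intf'.
have diff0 : (\int[mu]_(x in A) `|(f x - f' x)%:E| = 0)%E.
  rewrite (eq_integral (fun x => (f x - f' x)%:E)); last first.
    move=> x; rewrite inE /A/= => f'f.
    by rewrite ger0_norm// subr_ge0 ltW.
  rewrite integralB_EFin// (fB _ DA) -(f'B _ DA) subee//.
  exact: integrable_fin_num.
have mdiff : measurable_fun A (fun x => (f x - f' x)%:E).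
  by have /measurable_int := integrableB mA intfA intf'A.
have := (ae_eq_integral_abs mu mA mdiff).1 diff0.
apply: filterS => x /= fA0; rewrite leNgt; apply/negP => f'f.
have /eqP := fA0 f'f; rewrite eqe subr_eq0 => /eqP ff'.
by move: f'f; rewrite ff' ltxx.
Qed.

Lemma cond_prob_ae_eq (mu : probability (config G) R) D B (f f' : config G -> R) :
  cond_prob mu D B f -> cond_prob mu D B f' -> {ae mu, forall x, f x = f' x}.
Proof.
move=> cf cf'; have := cond_prob_ae_le cf cf'; have := cond_prob_ae_le cf' cf.
by apply: filterS2 => x le1 le2; apply/le_anti; rewrite le1 le2.
Qed.

End coordinate_algebra.

Lemma integral_ae_bounds d (T : measurableType d) (R : realType)
    (mu : probability T R) (f : T -> R) (lo hi : R) :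
  lo <= hi -> mu.-integrable setT (EFin \o f) ->
  {ae mu, forall x, lo <= f x <= hi} ->
  lo <= fine (\int[mu]_x (f x)%:E)%E <= hi.
Proof.
move=> lohi intf bnd.
have cst_int c : (\int[mu]_x (cst c%:E) x)%E = c%:E.
  by rewrite integral_cst//= probability_setT mule1.
have [mf _] := integrableP _ _ _ intf.
(* Clamping to the interval changes [f] only on a null set and turns the almost sure bounds into
   pointwise ones. *)
pose f' x := Num.min (Num.max (f x) lo) hi.
have mf' : measurable_fun setT f'.
  apply: measurable_minr => //; apply: measurable_maxr => //.
  exact/measurable_EFinP.
have ff' : (\int[mu]_x (f x)%:E = \int[mu]_x (f' x)%:E)%E.
  apply: ae_eq_integral => //; first exact/measurable_EFinP.
  apply: filterS bnd => x /andP[lof fhi] _ /=.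
  by rewrite /f' (max_idPl _)// (min_idPl _).
have f'lo x : lo <= f' x by rewrite le_min lohi le_max lexx orbT.
have f'hi x : f' x <= hi by rewrite ge_min lexx orbT.
have cst_integrable c : mu.-integrable setT (cst c%:E).
  by apply: finite_measure_integrable_cst.
have intf' : mu.-integrable setT (EFin \o f').
  apply/integrableP; split; first exact/measurable_EFinP.
  have /integrableP[_] := intf; apply: le_lt_trans; rewrite le_eqVlt.
  apply/orP; left; apply/eqP/ae_eq_integral => //.
  - by apply: measurableT_comp => //; exact/measurable_EFinP.
  - exact: measurableT_comp.
  - apply: filterS bnd => x /andP[lof fhi] _ /=.
    by rewrite /f' (max_idPl _)// (min_idPl _).
have le1 := le_integral measurableT (cst_integrable lo) intf'.
have le2 := le_integral measurableT intf' (cst_integrable hi).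
rewrite -2!lee_fin fineK; last first.
  by rewrite ff'; exact: integrable_fin_num.
rewrite ff' -(cst_int lo) -(cst_int hi).
by apply/andP; split; [apply: le1|apply: le2] => x _; rewrite lee_fin.
Qed.

(** * Kernel bounds along Folner sets and the two conclusions *)

Lemma kernel_bounds_folner (R : realType) (G : groupType)
    (Gamenable : amenable R G) (E : nat -> {fset G}) (Eexh : exhausting E)
    (phi : config G -> R) (phi_exp : exp_summable phi)
    (phi_var : summable_variation phi E) (eps : R) : 0 < eps ->
  \forall F \near folner R G, F != fset0 /\
    forall (w : {ffun F -> nat}) (x y : config G), crestrict F y = w ->
      expR (- eps * #|` F|%:R)
      <= gibbs_kernel phi E F (ccylinder w) x
         / expR (birkhoff phi F y - pressure phi * #|` F|%:R)
      <= expR (eps * #|` F|%:R).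
Proof.
(* Four quarters are spent: one on the level sums, two on the oscillation inside [F], one on
   replacing [log_partition] by the pressure. *)
move=> eps0; have e0 : 0 < eps / 4 by rewrite divr_gt0.
have h1 := folner_boundary (fset0 : {fset G}) e0.
have h2 := oscillation_folner Eexh phi_var e0.
have /cvgrPdist_le/(_ _ e0) h3 := log_partition_cvg phi_exp Gamenable.
apply: filterS3 h1 h2 h3 => F [F0 _] [osc levt] near_p; split=> // w x y yw.
have n0 : 0 < #|` F|%:R :> R by rewrite ltr0n cardfs_gt0.
have := gibbs_kernel_bounds Eexh phi_exp phi_var x F0 yw osc levt.
have : `|pressure phi * #|` F|%:R - log_partition phi F| <= eps / 4 * #|` F|%:R.
  rewrite -[log_partition phi F](mulVKf (lt0r_neq0 n0)) [_ * (_ * _)]mulrC -mulrBl.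
  by rewrite normrM (gtr0_norm n0) ler_wpM2r// ltW.
rewrite ler_pdivlMr ?expR_gt0// ler_pdivrMr ?expR_gt0// -!expRD.
rewrite ler_distl => /andP[p1 p2] /andP[lo hi].
move: (birkhoff phi F y) (log_partition phi F) (pressure phi) (#|` F|%:R)
  p1 p2 lo hi => b L p n p1 p2 lo hi.
apply/andP; split.
  by apply: le_trans lo; rewrite ler_expR; lra.
by apply: le_trans hi _; rewrite ler_expR; lra.
Qed.

Theorem theorem5p8 (R : realType) (G : groupType)
  (Gcountable : countable [set: G]) (Gamenable : amenable R G)
  (E : nat -> {fset G}) (Eexh : exhausting E)
  (phi : config G -> R) (phi_exp : exp_summable phi)
  (phi_var : summable_variation phi E)
  (mu : probability (config G) R) (mu_DLR : DLR phi E mu) :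
  (forall eps : R, 0 < eps ->
    exists (K : {fset G}) (delta : R),
      [/\ K != fset0, 0 < delta &
          forall F : {fset G}, almost_invariant K delta F ->
          forall (w : {ffun F -> nat}) (y : config G), crestrict F y = w ->
          forall f : config G -> R,
            cond_prob mu (~` [set` F]) (ccylinder w) f ->
            {ae mu, forall x,
               expR (- eps * #|` F|%:R)
               <= f x / expR (birkhoff phi F y - pressure phi * #|` F|%:R)
               <= expR (eps * #|` F|%:R)}])
  /\ bowen_gibbs phi mu.
Proof.
have bounds eps : 0 < eps -> \forall F \near folner R G, F != fset0 /\
    forall (w : {ffun F -> nat}) (y : config G), crestrict F y = w ->
    forall f : config G -> R, cond_prob mu (~` [set` F]) (ccylinder w) f ->
      {ae mu, forall x, expR (- eps * #|` F|%:R)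
         <= f x / expR (birkhoff phi F y - pressure phi * #|` F|%:R)
         <= expR (eps * #|` F|%:R)}.
  move=> eps0; have := kernel_bounds_folner Gamenable Eexh phi_exp phi_var eps0.
  apply: filterS => F [F0 ker]; split=> // w y yw f cf.
  (* The DLR property supplies one version equal to the kernel almost everywhere; uniqueness of
     versions carries the bounds to [f]. *)
  have [f' cf' f'E] := mu_DLR _ _ F0 (measurable_ccylinder w).
  have := cond_prob_ae_eq cf cf'; move: f'E.
  by apply: filterS2 => x f'x ->; rewrite f'x; exact: ker.
split=> [eps /bounds[K [d [K0 d0 KF]]]|].
  by exists K, d; split=> // F /KF[].
exists (pressure phi) => eps eps0; have [K [d [K0 d0 KF]]] := bounds _ eps0.
exists K, d; split=> // F x /KF[F0 fb].
have [f cf _] := mu_DLR _ _ F0 (measurable_ccylinder (crestrict F x)).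
have [_ intf fint] := cf.
(* The whole space is an event of the coordinate sigma-algebra, so integrating the conditional
   probability over it gives the measure of the cylinder, and the almost sure bounds pass to it. *)
have sT : <<s coord_events (~` [set` F]) >> [set: config G].
  exact: (@measurableT _ (g_sigma_algebraType (coord_events (~` [set` F])))).
rewrite -(setTI (ccylinder _)) -(fint _ sT).
rewrite ler_pdivlMr ?expR_gt0// ler_pdivrMr ?expR_gt0//.
apply: integral_ae_bounds => //.
  rewrite ler_wpM2r ?expR_ge0// ler_expR ler_wpM2r//; lra.
have := fb _ _ erefl f cf; apply: filterS => y.
by rewrite ler_pdivlMr ?expR_gt0// ler_pdivrMr ?expR_gt0.
Qed.
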